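(* Let $S=R[x;\tau,\delta]$ be a Cauchon extension with respect to a torus $H$ such that $\tau$ acts diagonalizably on $R$. Let $W$ be a Coxeter group with fixed generating set, $a$ one of its generators, and $\overline w\in W$ with $\overline w<\overline wa$. Let $\nabla:W^{\leq\overline w}\to\operatorname{spec}_HR$ be an isomorphism of partially ordered sets satisfying either (A) $\nabla(W_3)=\mathcal P_3$, and $\tilde C(\nabla(w))\cap R=\nabla(\Phi(w))$ for all $w\in W_1\cup W_2$; or (B) $\nabla(W_i)=\mathcal P_i$ for $i=1,2,3$. Let $\tilde\nabla:W^{\leq\overline wa}\to\operatorname{spec}_HS$ be the poset isomorphism given by $\tilde\nabla(w)=\tilde C(\nabla(w))$ for $w\in W^{\leq\overline w}$ and $\tilde\nabla(w)=\nabla(wa)_x$ otherwise. Then the square with sides $\tilde\nabla$, $\Phi$, $\tilde\Psi$, $\nabla$ commutes, i.e. $\tilde\Psi\circ\tilde\nabla=\nabla\circ\Phi$ as maps $W^{\leq\overline wa}\to\operatorname{spec}_HR$.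
   Context: **Coxeter side.** $W$ is a Coxeter group $\langle s_1,\dots,s_n:(s_is_j)^{m_{ij}}=1\rangle$ considered with respect to this fixed generating set (''generator'' means one of the $s_i$); $\leq$ is the Bruhat order, and $W^{\leq v}=[1,v]=\{w\in W:w\leq v\}$ with the induced order. For $\overline w<\overline wa$ set $W_1=\{w\in W^{\leq\overline wa}:wa\leq w\leq\overline w\}$, $W_2=\{w\in W^{\leq\overline wa}:w\leq wa\leq\overline w\}$, $W_3=\{w\in W^{\leq\overline wa}:wa\not\leq\overline w\}$; one has $W_1\cup W_2\cup W_3=W^{\leq\overline w}$. The projection $\Phi:W^{\leq\overline wa}\to W^{\leq\overline w}$ is $\Phi(w)=w$ if $w\leq wa$ and $\Phi(w)=wa$ if $wa\leq w$. **Cauchon extensions.** $k$ is a field. Let $R$ be a noetherian $k$-algebra and $S=R[x;\tau,\delta]$ an Ore extension ($\tau$ an algebra automorphism of $R$, $\delta$ a $k$-linear $\tau$-derivation, $xr=\tau(r)x+\delta(r)$ for $r\in R$). $S$ is a Cauchon extension of $R$ (with respect to $H$) if: (i) $\delta$ is locally nilpotent; (ii) $\delta\tau=q\tau\delta$ with $q\in k^\times$ not a root of unity; (iii) $H$ is an abelian group acting on $S$ by algebra automorphisms; (iv) $R$ is $H$-stable and $x$ is an $H$-eigenvector; (v) there is $h_0\in H$ such that $h_0|_R=\tau$ and the $h_0$-eigenvalue of $x$ is not a root of unity; (vi) every $H$-prime ideal of $R$ is completely prime. (An $H$-prime ideal is a proper $H$-stable ideal $P$ such that $IJ\subseteq P$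 with $I,J$ $H$-stable ideals implies $I\subseteq P$ or $J\subseteq P$.) Here $H$ is moreover a torus. ''$\tau$ acts diagonalizably on $R$'' means $R$ is spanned by $\tau$-eigenvectors. $\operatorname{spec}_HA$ denotes the set of $H$-stable (torus-invariant) prime ideals of $A$, ordered by inclusion. **Subsets of the spectrum of $R$.** $\mathcal P_3=\{P\in\operatorname{spec}_HR:\delta(R)\subseteq P\}$, $\mathcal P_2=\{P\in\operatorname{spec}_HR:\delta(P)\subseteq P\}\setminus\mathcal P_3$, $\mathcal P_1=\operatorname{spec}_HR\setminus(\mathcal P_2\cup\mathcal P_3)$. **Maps.** Let $L=S[x^{-1}]$. Cauchon's deleting-derivation homomorphism is $C:R\to L$, $C(r)=\sum_{l\geq0}q_l\,\delta^l\tau^{-l}(r)x^{-l}$ with $q_l=q^{l(l+1)/2}(q-1)^{-l}/(l)!_q$, $(l)!_q=\prod_{i=1}^l\frac{q^i-1}{q-1}$. Define $\tilde C:\operatorname{spec}_HR\to\{Q\in\operatorname{spec}_HS:x\notin Q\}$ by $\tilde C(P)=\langle C(P)\rangle_L\cap S$. For $P\in\operatorname{spec}_HR$, $P_x=\langle P\cup\{x\}\rangle_S$ (two-sided ideal generated). $\tilde\Psi:\operatorname{spec}_HS\to\operatorname{spec}_HR$ is the contraction map $Q\mapsto Q\cap R$. Under (A) or (B), $\tilde\nabla$ as given is a well-defined poset isomorphism. *)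

(* Defs.v *)
From mathcomp Require Import all_boot all_algebra.
From mathcomp Require Import boolp classical_sets functions fsbigop.
From Stdlib Require Import Relation_Operators.

Set Implicit Arguments.
Unset Strict Implicit.
Unset Printing Implicit Defensive.

Import GRing.Theory.

Local Open Scope classical_set_scope.
Local Open Scope ring_scope.

(* The value 0 encodes m_ij = oo. *)
Definition coxeter_matrix (n : nat) (m : 'I_n -> 'I_n -> nat) : Prop :=
  [/\ forall i, m i i = 1%N,
      forall i j, m i j = m j i
    & forall i j, i != j -> m i j <> 1%N].

(* When m_ij = oo the equation below is x ^+ 0 = 1, i.e. no relation. *)
Definition coxeter_relations (n : nat) (m : 'I_n -> 'I_n -> nat)
    (G : groupType) (t : 'I_n -> G) : Prop :=
  forall i j, ((t i * t j) ^+ m i j = 1)%g.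

(* W = < s_1, ..., s_n : (s_i s_j)^(m_ij) = 1 >, through the universal property
   of a group presentation. *)
Definition coxeter_group (n : nat) (m : 'I_n -> 'I_n -> nat)
    (W : groupType) (s : 'I_n -> W) : Prop :=
  [/\ coxeter_matrix m,
      coxeter_relations m s
    & forall (G : groupType) (t : 'I_n -> G), coxeter_relations m t ->
        exists! f : W -> G,
          {morph f : u v / (u * v)%g} /\ forall i, f (s i) = t i].

Section Bruhat.
Variables (n : nat) (W : groupType) (s : 'I_n -> W).

Definition has_word (w : W) (l : nat) : Prop :=
  exists2 e : seq 'I_n, size e = l & w = (\prod_(i <- e) s i)%g.

Definition has_length (w : W) (l : nat) : Prop :=
  has_word w l /\ forall l', has_word w l' -> (l <= l')%N.

Definition reflection (t : W) : Prop :=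
  exists (g : W) (i : 'I_n), t = (g * s i * g^-1)%g.

Definition bruhat_step (u v : W) : Prop :=
  (exists2 t, reflection t & v = (u * t)%g) /\
  (exists lu lv : nat, [/\ has_length u lu, has_length v lv & (lu < lv)%N]).

Definition bruhat : W -> W -> Prop := clos_refl_trans W bruhat_step.

Definition bruhat_lt (u v : W) : Prop := bruhat u v /\ u <> v.

Definition lower_interval (v : W) : set W := [set w | bruhat w v].

Variables (wb a : W).

Definition W1 : set W := [set w | [/\ lower_interval (wb * a)%g w,
  bruhat (w * a)%g w & bruhat w wb]].

Definition W2 : set W := [set w | [/\ lower_interval (wb * a)%g w,
  bruhat w (w * a)%g & bruhat (w * a)%g wb]].

Definition W3 : set W := [set w | lower_interval (wb * a)%g w /\
  ~ bruhat (w * a)%g wb].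

(* For a generator a, exactly one of w <= wa and wa <= w holds. *)
Definition Phi (w : W) : W :=
  if pselect (bruhat w (w * a)%g) then w else (w * a)%g.

End Bruhat.

Section Ideals.
Variable A : nzRingType.
Implicit Types I J P : set A.

Definition left_ideal I : Prop :=
  [/\ I 0, forall a b, I a -> I b -> I (a + b)
    & forall c a, I a -> I (c * a)].

Definition right_ideal I : Prop :=
  [/\ I 0, forall a b, I a -> I b -> I (a + b)
    & forall c a, I a -> I (a * c)].

Definition ideal I : Prop := left_ideal I /\ right_ideal I.

Definition ideal_gen (X : set A) : set A := smallest ideal X.

Definition acc (C : set A -> Prop) : Prop :=
  forall F : nat -> set A, (forall i, C (F i)) ->
    (forall i, F i `<=` F i.+1) ->
    exists N, forall i, (N <= i)%N -> F i = F N.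

Definition noetherian : Prop := acc left_ideal /\ acc right_ideal.

(* IJ `<=` P, for P an ideal. *)
Definition prod_sub I J P : Prop := forall a b, I a -> J b -> P (a * b).

Definition prime_ideal P : Prop :=
  [/\ ideal P, P <> setT
    & forall I J, ideal I -> ideal J -> prod_sub I J P ->
        I `<=` P \/ J `<=` P].

Definition completely_prime_ideal P : Prop :=
  [/\ ideal P, P <> setT & forall a b, P (a * b) -> P a \/ P b].

Variables (H : Type) (act : H -> A -> A).

Definition H_stable I : Prop := forall h, act h @` I `<=` I.

Definition H_prime_ideal P : Prop :=
  [/\ ideal P, H_stable P, P <> setT
    & forall I J, ideal I -> H_stable I -> ideal J -> H_stable J ->
        prod_sub I J P -> I `<=` P \/ J `<=` P].

Definition spec_H : set (set A) := [set P | prime_ideal P /\ H_stable P].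

End Ideals.

(* Isomorphism from the Bruhat-ordered set D onto the inclusion-ordered set E;
   only the values of f on D matter. *)
Definition poset_iso (W : Type) (le : W -> W -> Prop) (A : Type)
    (D : set W) (E : set (set A)) (f : W -> set A) : Prop :=
  set_bij D E f /\
  forall u v, D u -> D v -> (le u v <-> f u `<=` f v).

Definition root_of_unity (k : fieldType) (c : k) : Prop :=
  exists2 l, (0 < l)%N & c ^+ l = 1.

(* H is isomorphic to G_m(k)^r for some r, G_m(k) the units of k. *)
Definition torus (k : fieldType) (H : groupType) : Prop :=
  exists (r : nat) (f : H -> 'I_r -> k),
    set_bij setT [set v | forall i, v i != 0] f /\
    forall g h i, f (g * h)%g i = f g i * f h i.

Definition group_action (H : groupType) (T : Type) (act : H -> T -> T) : Prop :=
  act 1%g =1 id /\ forall g h, act (g * h)%g =1 act g \o act h.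

(* S = R[x; tau, delta]: S contains R (via iota) and is free as a left
   R-module on the powers of x; the polynomial p holds left coefficients. *)
Record ore_extension (k : fieldType) (R S : algType k)
    (iota : {lrmorphism R -> S}) (tau : {lrmorphism R -> R})
    (delta : {linear R -> R}) (x : S) : Prop := OreExtension {
  ore_tau_bij : bijective tau;
  ore_delta_der : forall r r', delta (r * r') = tau r * delta r' + delta r * r';
  ore_comm : forall r, x * iota r = iota (tau r) * x + iota (delta r);
  ore_free : forall y : S, exists! p : {poly R},
    y = \sum_(i < size p) iota p`_i * x ^+ i
}.

(* actR is the restriction of actS to the H-stable subalgebra R. *)
Record cauchon_extension (k : fieldType) (R S : algType k)
    (iota : {lrmorphism R -> S}) (tau : {lrmorphism R -> R})
    (delta : {linear R -> R}) (x : S) (q : k) (H : groupType)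
    (actR : H -> {lrmorphism R -> R}) (actS : H -> {lrmorphism S -> S}) : Prop :=
  CauchonExtension {
  cauchon_noetherian : noetherian R;
  cauchon_ore : ore_extension iota tau delta x;
  cauchon_nilp : forall r, exists l, iter l delta r = 0;
  cauchon_q_neq0 : q != 0;
  cauchon_q_root : ~ root_of_unity q;
  cauchon_skew : forall r, delta (tau r) = q *: tau (delta r);
  cauchon_H_abelian : forall g h : H, (g * h = h * g)%g;
  cauchon_action : group_action (fun h => actS h : S -> S);
  cauchon_R_stable : forall h r, actS h (iota r) = iota (actR h r);
  cauchon_x_eigen : forall h, exists c : k, actS h x = c *: x;
  cauchon_h0 : exists (h0 : H) (c : k),
    [/\ actR h0 =1 tau, actS h0 x = c *: x & ~ root_of_unity c];
  cauchon_H_prime : forall P : set R,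
    H_prime_ideal (fun h => actR h : R -> R) P -> completely_prime_ideal P
}.

(* R is spanned by eigenvectors of f. *)
Definition diagonalizable_map (k : fieldType) (R : lmodType k) (f : R -> R) :
    Prop :=
  forall r : R, exists (d : nat) (c : 'I_d -> k) (v : 'I_d -> R),
    (forall i, v i != 0 /\ exists l : k, f (v i) = l *: v i) /\
    r = \sum_(i < d) c i *: v i.

(* L = S[x^-1], as a ring of right fractions. *)
Definition localization (k : fieldType) (S : algType k) (L : unitAlgType k)
    (j : {lrmorphism S -> L}) (x : S) : Prop :=
  [/\ injective j,
      j x \is a GRing.unit
    & forall y : L, exists (u : S) (l : nat), y = j u * j x ^- l].

Section Spectrum.
Variables (k : fieldType) (R S : algType k).
Variables (delta : R -> R) (H : Type) (actR : H -> R -> R).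

Definition cP3 : set (set R) :=
  [set P | spec_H actR P /\ range delta `<=` P].

Definition cP2 : set (set R) :=
  [set P | spec_H actR P /\ delta @` P `<=` P] `\` cP3.

Definition cP1 : set (set R) := spec_H actR `\` (cP2 `|` cP3).

Variables (iota : R -> S) (x : S).

Definition extend_x (P : set R) : set S := ideal_gen (iota @` P `|` [set x]).

Definition contraction (Q : set S) : set R := iota @^-1` Q.

End Spectrum.

Section DeletingDerivation.
Variables (k : fieldType) (R S : algType k) (L : unitAlgType k).
Variables (iota : R -> S) (j : S -> L) (tauV delta : R -> R) (x : S) (q : k).

Definition qfact (l : nat) : k :=
  \prod_(1 <= i < l.+1) ((q ^+ i - 1) / (q - 1)).

Definition cauchon_coef (l : nat) : k :=
  q ^+ (l * l.+1)./2 * (q - 1) ^- l / qfact l.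

(* tauV stands for tau^-1; the sum has finite support because delta is locally
   nilpotent and q-commutes with tau. *)
Definition cauchon_map (r : R) : L :=
  \sum_(l \in [set: nat])
    cauchon_coef l *: (j (iota (iter l delta (iter l tauV r))) * j x ^- l).

Definition cauchon_tilde (P : set R) : set S :=
  j @^-1` ideal_gen (cauchon_map @` P).

End DeletingDerivation.

Definition nabla_tilde (n : nat) (W : groupType) (s : 'I_n -> W) (wb a : W)
    (R S : Type) (Ct Ex : set R -> set S) (nabla : W -> set R) (w : W) : set S :=
  if pselect (bruhat s w wb) then Ct (nabla w) else Ex (nabla (w * a)%g).

(* Main.v *)
(* Coxeter side. A word [s_1 ... s_l] of [w] determines the reflections
   [s_1 ... s_(k-1) s_k s_(k-1) ... s_1]; the parity [N w r] of the number of
   occurrences of [r] among them is a cocycle depending on [w] only, and [r w] is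
   shorter than [w] exactly when [N w r] is odd. As the cocycle of [u a] differs
   from that of [u] only at [u a u^-1], every Bruhat step [u < v] with [v <> u a]
   gives a step [u a < v a], whence the lifting property of the Bruhat order.

   Ring side. The map [C] is a ring morphism with [x C(r) = C(tau r) x], which
   makes [L] a skew Laurent ring over [C(R)] and
   [r = \sum_l c_l C(delta^l tau^-l r) x^-l] with all [c_l <> 0]. Hence the ideal
   generated by [C(P)] contracts to [{r | delta^l r \in P for all l}], the largest
   delta-stable ideal inside [P]. It is completely prime when [P] is, by the top
   term of the q-Leibniz rule, so it is again in [spec_H R].

   For [w] in [W_1] in case (B), this contraction is therefore [nabla v] with
   [v] in [W_2] or [W_3]; then [v <= w] and [v <= v a] force [v <= w a], and
   [nabla (w a)] is itself delta-stable inside [nabla w]. The other cases are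
   those in which [nabla w] is delta-stable or contains [delta R]. *)
Require Import Defs.
From HB Require Import structures.
From mathcomp Require Import all_boot all_algebra.
From mathcomp Require Import boolp classical_sets functions fsbigop.
From mathcomp Require Import ring zify.
From Stdlib Require Import Relation_Operators.

Set Implicit Arguments.
Unset Strict Implicit.
Unset Printing Implicit Defensive.

Import GRing.Theory.

Local Open Scope classical_set_scope.
Local Open Scope ring_scope.

(** * Truncation and antidiagonal resummation of finite sums *)

Lemma sum_ord_trunc (V : zmodType) (F : nat -> V) N M : (N <= M)%N ->
  (forall i, (N <= i)%N -> F i = 0) -> \sum_(i < M) F i = \sum_(i < N) F i.
Proof.
move=> NM F0; rewrite -!(big_mkord xpredT F) (big_cat_nat (n := N)) //=.
by rewrite [X in _ + X]big_nat_cond [X in _ + X]big1 ?addr0 // => i /andP[/andP[/F0]].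
Qed.

(** The triangle [i + j < N + N] contains the square [i, j < N], and [F] vanishes on the rest of it.
    This collects products and compositions of truncated series by total degree. *)
Lemma sum_antidiagonal (V : zmodType) (F : nat -> nat -> V) N :
    (forall i j, (N <= i)%N || (N <= j)%N -> F i j = 0) ->
  \sum_(n < N + N) \sum_(i < n.+1) F i (n - i)%N =
  \sum_(i < N) \sum_(j < N) F i j.
Proof.
move=> F0; have triangle M : \sum_(n < M) \sum_(i < n.+1) F i (n - i)%N =
    \sum_(i < M) \sum_(j < M - i) F i j.
  elim: M => [|M IH]; first by rewrite !big_ord0.
  rewrite big_ord_recr IH /= [in LHS]big_ord_recr [in RHS]big_ord_recr /=.
  rewrite subSnn big_ord_recr big_ord0 subnn /= add0r addrA -big_split /=.
  congr (_ + _); apply: eq_bigr => i _.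
  by rewrite subSn 1?ltnW // big_ord_recr.
rewrite triangle (@sum_ord_trunc _ (fun i => \sum_(j < N + N - i) F i j) N).
- apply: eq_bigr => i _; apply: sum_ord_trunc => [|j jN]; last by rewrite F0 ?jN ?orbT.
  by have := ltn_ord i; lia.
- exact: leq_addr.
- by move=> i iN; rewrite big1 // => j _; rewrite F0 ?iN.
Qed.

(** * q-numbers and the coefficients of Cauchon's map *)

Section QNumbers.
Variables (k : fieldType) (q : k).
Hypotheses (q0 : q != 0) (q_root : ~ Defs.root_of_unity q).

Definition qnat (l : nat) : k := (q ^+ l - 1) / (q - 1).

Lemma qpow_sub1_neq0 l : q ^+ l.+1 - 1 != 0.
Proof. by rewrite subr_eq0; apply/eqP => ql; apply: q_root; exists l.+1. Qed.

Lemma q_sub1_neq0 : q - 1 != 0.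
Proof. by have := qpow_sub1_neq0 0. Qed.

Lemma qnat0 : qnat 0 = 0.
Proof. by rewrite /qnat subrr mul0r. Qed.

Lemma qnat_neq0 l : qnat l.+1 != 0.
Proof. by rewrite mulf_neq0 ?invr_neq0 ?qpow_sub1_neq0 ?q_sub1_neq0. Qed.

Lemma qnatD i j : qnat (i + j) = qnat j + q ^+ j * qnat i.
Proof. by rewrite /qnat exprD; set v := (q - 1)^-1; ring. Qed.

Lemma qfact0 : qfact q 0 = 1.
Proof. by rewrite /qfact big_geq. Qed.

Lemma qfactS l : qfact q l.+1 = qfact q l * qnat l.+1.
Proof. by rewrite /qfact big_nat_recr. Qed.

Lemma qfact_neq0 l : qfact q l != 0.
Proof.
by elim: l => [|l IH]; rewrite ?qfact0 ?oner_neq0 // qfactS mulf_neq0 ?qnat_neq0.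
Qed.

Local Notation cf := (cauchon_coef q).

Lemma cauchon_coef0 : cf 0 = 1.
Proof. by rewrite /cauchon_coef qfact0 expr0 mul1r divr1 invr1. Qed.

Lemma half_mul_succD i j : ((i + j) * (i + j).+1)./2 =
  ((i * i.+1)./2 + (j * j.+1)./2 + i * j)%N.
Proof.
have even_mul_succ l : (l * l.+1)./2.*2 = (l * l.+1)%N.
  by rewrite -[RHS]odd_double_half oddM /= andbN.
by apply: double_inj; rewrite !doubleD !even_mul_succ -!addnn; lia.
Qed.

(** The exponent of [q] is quadratic in [l], hence the cross term [q ^+ (i * j)]. It will cancel the
    factor produced by moving powers of [tau] past powers of [delta]. *)
Lemma cauchon_coefD i j : cf (i + j) * qfact q (i + j) =
  q ^+ (i * j) * (cf i * qfact q i) * (cf j * qfact q j).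
Proof.
rewrite /cauchon_coef !divfK ?qfact_neq0 // half_mul_succD !exprD.
have := q_sub1_neq0 => /expf_neq0 qn0; field.
by rewrite !qn0.
Qed.

(** This recurrence is what makes the sum in [cauchon_map_twist] telescope. *)
Lemma cauchon_coefS l : cf l.+1 * (q ^+ l.+1 - 1) = q ^+ l.+1 * cf l.
Proof.
have -> : cf l.+1 = q ^+ ((l * l.+1)./2 + l.+1) * (q - 1) ^- l.+1 / qfact q l.+1.
  by congr (_ ^+ _ * _ / _); rewrite -addn1 half_mul_succD; lia.
rewrite qfactS /qnat /cauchon_coef exprD [(q - 1) ^+ _]exprS [q ^+ l.+1]exprS.
have := q_sub1_neq0; have := qfact_neq0 l; have := qpow_sub1_neq0 l => ql qf qn.
have := expf_neq0 l qn => qnl; rewrite exprS in ql *.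
by field; rewrite qf qnl qn ql.
Qed.

(* Coefficients of the inverse expansion [rho r = \sum_l c_l C(E_l r) X^-l], see
   [inverse_cauchon_map]. *)
Fixpoint inverse_coef l : k :=
  if l is l'.+1 then inverse_coef l' * q ^+ (l' + l) / (1 - q ^+ l) else 1.

Lemma inverse_coef_neq0 l : inverse_coef l != 0.
Proof.
elim: l => [|l IH] /=; first exact: oner_neq0.
by rewrite !mulf_neq0 ?invr_neq0 ?expf_neq0 // -opprB oppr_eq0 qpow_sub1_neq0.
Qed.

Lemma inverse_coefS l :
  inverse_coef l.+1 * (1 - q ^+ l.+1) = inverse_coef l * q ^+ (l + l.+1).
Proof. by rewrite /= divfK // -opprB oppr_eq0 qpow_sub1_neq0. Qed.

(* Multiplying the sum by [1 - q ^ N = (1 - q ^ i) + q ^ i (1 - q ^ (N - i))]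
   turns it, by the recurrences of both factors, into a difference of two equal
   sums. *)
Lemma inverse_coefE N : \sum_(i < N.+1)
  inverse_coef i * cf (N - i) * q ^+ (i * (N - i)) = (N == 0)%:R.
Proof.
case: N => [|N]; first by rewrite big_ord1 /= cauchon_coef0 expr0 !mulr1.
have := qpow_sub1_neq0 N => qN; apply: (mulfI qN); rewrite mulr0 mulr_sumr.
apply/eqP; rewrite -oppr_eq0 -sumrN; apply/eqP.
rewrite (eq_bigr (fun i : 'I_N.+2 =>
  inverse_coef i * (1 - q ^+ i) * cf (N.+1 - i) * q ^+ (i * (N.+1 - i)) -
  inverse_coef i * (cf (N.+1 - i) * (q ^+ (N.+1 - i) - 1)) *
    q ^+ (i * (N.+1 - i)) * q ^+ i)); last first.
  move=> i _; have -> : q ^+ N.+1 = q ^+ i * q ^+ (N.+1 - i).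
    by rewrite -exprD subnKC // -ltnS.
  by ring.
rewrite sumrB big_ord_recl [X in _ - X]big_ord_recr /=.
rewrite subnn subrr !(mulr0, mul0r) add0r addr0; apply/eqP; rewrite subr_eq0.
apply/eqP/eq_bigr => i _; have iN : (i <= N)%N by rewrite -ltnS.
rewrite /bump leq0n add1n subSS (subSn iN).
rewrite inverse_coefS cauchon_coefS.
rewrite !mulSn !mulnS !(exprD, exprS); ring.
Qed.
End QNumbers.

(** * Ideals of skew Laurent rings *)

Section SkewEval.
Variables (R L : nzRingType) (C : {rmorphism R -> L}) (X : L).

(** Here [{poly R}] only stores left coefficients: as [X] need not commute with [C r], evaluation is
    additive and respects right multiplication by ['X], but is not multiplicative in general. *)
Definition skew_eval (p : {poly R}) : L := (map_poly C p).[X].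
Local Notation T := skew_eval.

Lemma skew_evalE p : T p = \sum_(i < size p) C p`_i * X ^+ i.
Proof.
rewrite /T (horner_coef_wide _ (size_poly _ _)).
by apply: eq_bigr => i _; rewrite coef_map.
Qed.

Lemma skew_evalD p p' : T (p + p') = T p + T p'.
Proof. by rewrite /T rmorphD hornerD. Qed.

Lemma skew_evalB p p' : T (p - p') = T p - T p'.
Proof. by rewrite /T rmorphB hornerD hornerN. Qed.

Lemma skew_eval0 : T 0 = 0.
Proof. by rewrite /T rmorph0 horner0. Qed.

Lemma skew_evalMX p : T (p * 'X) = T p * X.
Proof. by rewrite /T rmorphM /= map_polyX hornerMX. Qed.

Lemma skew_evalC c : T c%:P = C c.
Proof. by rewrite /T map_polyC hornerC. Qed.

Lemma skew_evalMXn p e : T (p * 'X^e) = T p * X ^+ e.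
Proof.
elim: e => [|e IH]; first by rewrite !expr0 !mulr1.
by rewrite !exprSr mulrA skew_evalMX IH mulrA.
Qed.

End SkewEval.

Section SkewLaurent.
Variables (R : nzRingType) (L : unitRingType) (C : {rmorphism R -> L}).
Variables (tau : {rmorphism R -> R}) (tauV : R -> R) (X : L).
Hypotheses (tauK : cancel tau tauV) (tauVK : cancel tauV tau).
Hypothesis X_unit : X \is a GRing.unit.
Hypothesis C_twist : forall r, X * C r = C (tau r) * X.

Local Notation T := (skew_eval C X).

Hypothesis skew_eval_inj : forall p, T p = 0 -> p = 0.
Hypothesis skew_eval_gen : forall y, exists p e, y * X ^+ e = T p.

(** Clears denominators: a truncated series in [X^-1], multiplied by [X ^+ N], becomes a polynomial
    with the coefficients in reverse order. *)
Lemma skew_eval_poly_rev (f : nat -> R) N :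
  T (\poly_(i < N.+1) f (N - i)%N) = \sum_(l < N.+1) C (f l) * X ^- l * X ^+ N.
Proof.
rewrite (reindex_inj rev_ord_inj) /T poly_def rmorph_sum horner_sum /=.
apply: eq_bigr => i _; have iN : (i <= N)%N by rewrite -ltnS.
rewrite -mul_polyC -[_.[X]]/(T _) skew_evalMXn skew_evalC subSS.
have -> : X ^+ N = X ^+ (N - i) * X ^+ i by rewrite -exprD subnK.
by rewrite mulrA mulrVK ?unitrX.
Qed.

Lemma skew_eval_twist p : X * T p = T (map_poly tau p) * X.
Proof.
elim/poly_ind: p => [|p c IH]; first by rewrite rmorph0 skew_eval0 mulr0 mul0r.
rewrite rmorphD rmorphM /= map_polyX map_polyC !skew_evalD !skew_evalMX.
by rewrite !skew_evalC mulrDr mulrDl -C_twist mulrA IH.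
Qed.

Variable P : set R.
Hypotheses (P_ideal : ideal P) (P_tau : forall r, P r -> P (tau r)).
Hypothesis P_tauV : forall r, P r -> P (tauV r).

Let P0 : P 0. Proof. by case: P_ideal => -[]. Qed.
Let PD a b : P a -> P b -> P (a + b). Proof. by case: P_ideal => -[_ + _] _; apply. Qed.
Let Pl a b : P b -> P (a * b). Proof. by case: P_ideal => -[_ _ + ] _; apply. Qed.
Let Pr a b : P a -> P (a * b). Proof. by case: P_ideal => _ [_ _ +]; apply. Qed.

Definition coefs_in (p : {poly R}) := forall i, P p`_i.

Lemma coefs_inD p p' : coefs_in p -> coefs_in p' -> coefs_in (p + p').
Proof. by move=> pP p'P i; rewrite coefD; apply: PD. Qed.

Lemma coefs_inMXn p e : coefs_in p -> coefs_in (p * 'X^e).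
Proof. by move=> pP i; rewrite coefMXn; case: ifP. Qed.

Lemma coefs_in_addC p c : coefs_in (p * 'X + c%:P) -> coefs_in p /\ P c.
Proof.
move=> pcP; split=> [i|]; last by have := pcP 0; rewrite coefD coefMX coefC /= add0r.
by have := pcP i.+1; rewrite coefD coefMX coefC /= addr0.
Qed.

(** Explicit candidate for the ideal generated by the image of [P]: the fractions having some
    numerator with coefficients in [P]. *)
Definition laurent_ideal : set L :=
  [set y | exists p e, coefs_in p /\ y * X ^+ e = T p].

Local Notation J := laurent_ideal.

Lemma laurent_ideal0 : J 0.
Proof. by exists 0, 0%N; rewrite mul0r skew_eval0; split=> // i; rewrite coef0. Qed.

Lemma laurent_idealD y z : J y -> J z -> J (y + z).
Proof.
move=> [p [e [pP yE]]] [p' [e' [p'P zE]]].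
exists (p * 'X^e' + p' * 'X^e), (e + e')%N; split.
  by apply: coefs_inD; apply: coefs_inMXn.
by rewrite mulrDl skew_evalD !skew_evalMXn -yE -zE -!mulrA -!exprD [(e' + e)%N]addnC.
Qed.

(** Multipliers are closed under sums and products, so [J] is an ideal as soon as [X], its inverse
    and the [C r] are multipliers. *)
Definition ideal_multiplier (z : L) := forall y, J y -> J (z * y) /\ J (y * z).

Lemma multiplierD z z' :
  ideal_multiplier z -> ideal_multiplier z' -> ideal_multiplier (z + z').
Proof.
move=> zM z'M y Jy; have [? ?] := zM y Jy; have [? ?] := z'M y Jy.
by rewrite mulrDl mulrDr; split; apply: laurent_idealD.
Qed.

Lemma multiplierM z z' :
  ideal_multiplier z -> ideal_multiplier z' -> ideal_multiplier (z * z').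
Proof.
move=> zM z'M y Jy; have [zy yz] := zM y Jy; have [z'y yz'] := z'M y Jy.
by split; [rewrite -mulrA; case: (zM _ z'y)|rewrite mulrA; case: (z'M _ yz)].
Qed.

Lemma multiplier0 : ideal_multiplier 0.
Proof. by move=> y _; rewrite mul0r mulr0; split; apply: laurent_ideal0. Qed.

Lemma multiplier1 : ideal_multiplier 1.
Proof. by move=> y Jy; rewrite mul1r mulr1. Qed.

Lemma multiplierX : ideal_multiplier X.
Proof.
move=> y [p [e [pP yE]]]; split.
  exists (map_poly tau p * 'X^1), e; split.
    by apply: coefs_inMXn => i; rewrite coef_map; apply: P_tau.
  by rewrite -mulrA yE skew_eval_twist skew_evalMXn expr1.
exists (p * 'X^1), e; split; first exact: coefs_inMXn.
by rewrite -mulrA -exprS exprSr mulrA yE skew_evalMXn expr1.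
Qed.

Let tauV0 : tauV 0 = 0.
Proof. by apply: (can_inj tauK); rewrite tauVK rmorph0. Qed.

Lemma multiplierXV : ideal_multiplier X^-1.
Proof.
move=> y [p [e [pP yE]]]; split; last first.
  exists p, e.+1; split=> //; rewrite exprS mulrA mulrVK //.
exists (map_poly tauV p), e.+1; split=> [i|].
  by rewrite coef_map_id0 //; apply: P_tauV.
have pE : map_poly tau (map_poly tauV p) = p.
  by apply/polyP => i; rewrite coef_map coef_map_id0 //= tauVK.
apply: (mulrI X_unit); rewrite skew_eval_twist pE -yE !mulrA mulrV // mul1r.
by rewrite exprSr mulrA.
Qed.

Lemma skew_eval_mulC p r : exists p', T p * C r = T p' /\ (coefs_in p -> coefs_in p').
Proof.
elim/poly_ind: p r => [|p c IH] r.
  by exists 0; rewrite skew_eval0 mul0r.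
have [p' [p'E p'P]] := IH (tau r).
exists (p' * 'X + (c * r)%:P); split.
  rewrite !skew_evalD !skew_evalMX !skew_evalC -p'E mulrDl -!mulrA C_twist.
  by rewrite rmorphM.
move=> /coefs_in_addC[/p'P {}p'P cP] i; rewrite coefD coefMX coefC.
by case: i => [|i] /=; rewrite ?add0r ?addr0 //; apply: Pr.
Qed.

(** The witness is [tauV] applied [e] times to [r]. It lets a coefficient multiplied on the right of
    a fraction cross the denominator. *)
Lemma X_expV_C e r : exists r', C r * X ^+ e = X ^+ e * C r'.
Proof.
elim: e r => [|e IH] r; first by exists r; rewrite mulr1 mul1r.
have [r' r'E] := IH (tauV r); exists r'.
by rewrite exprS mulrA -{1}[r]tauVK -C_twist -!mulrA r'E.
Qed.

Lemma multiplierC r : ideal_multiplier (C r).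
Proof.
move=> y [p [e [pP yE]]]; split.
  exists (r%:P * p), e; split=> [i|]; first by rewrite coefCM; apply: Pl.
  by rewrite -mulrA yE /T rmorphM /= map_polyC hornerCM.
have [r' r'E] := X_expV_C e r; have [p' [p'E p'P]] := skew_eval_mulC p r'.
exists p', e; split; first exact: p'P.
by rewrite -mulrA r'E mulrA yE.
Qed.

Lemma multiplier_all z : ideal_multiplier z.
Proof.
have TM p : ideal_multiplier (T p).
  elim/poly_ind: p => [|p c IH]; first by rewrite skew_eval0; apply: multiplier0.
  rewrite skew_evalD skew_evalMX skew_evalC; apply: multiplierD.
    by apply: multiplierM IH multiplierX.
  exact: multiplierC.
have [p [e zE]] := skew_eval_gen z.
have -> : z = T p * X^-1 ^+ e by rewrite -zE exprVn mulrK ?unitrX.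
apply: multiplierM => //; elim: e {zE} => [|e IH]; first exact: multiplier1.
by rewrite exprS; apply: multiplierM multiplierXV IH.
Qed.

Lemma laurent_ideal_gen p e y : y * X ^+ e = T p ->
  ideal_gen (C @` P) y <-> coefs_in p.
Proof.
move=> yE; split=> [Py|pP].
  have [] : J y; last move=> p' [e' [p'P yE']] i.
    apply: Py; split; last first.
      move=> _ [c Pc <-]; exists c%:P, 0%N; rewrite mulr1 skew_evalC; split=> // i.
      by rewrite coefC; case: eqP.
    by split; split=> [|a b|c a]; [exact: laurent_ideal0 | exact: laurent_idealD
      | case/(multiplier_all c) | exact: laurent_ideal0 | exact: laurent_idealD
      | case/(multiplier_all c)].
  (* Two numerators of the same [y] agree after crosswise multiplication by the powers of [X], since
     [T] is injective; so membership can be tested on any numerator. *)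
  have : p * 'X^e' = p' * 'X^e.
    apply/eqP; rewrite -subr_eq0; apply/eqP/skew_eval_inj.
    rewrite /T rmorphB hornerD hornerN -!/(T _) !skew_evalMXn -yE -yE'.
    by rewrite -!mulrA -!exprD addnC subrr.
  move=> /(congr1 (fun p : {poly R} => p`_(i + e'))).
  rewrite !coefMXn ltnNge leq_addl /= addnK => ->.
  by case: ifP.
move=> K [[[K0 KD Kl] [_ _ Kr]] KP].
have KT : K (T p).
  elim/poly_ind: p pP {yE} => [_|p c IH /coefs_in_addC[pP Pc]].
    by rewrite skew_eval0.
  rewrite skew_evalD skew_evalMX skew_evalC; apply: (KD _ _); first by apply/Kr/IH.
  by apply: KP; exists c.
by rewrite -[y](mulrK (unitrX e X_unit)) yE; apply: Kr.
Qed.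

End SkewLaurent.

(** * Cauchon's map and delta-stable ideals *)

Lemma idealZ (k : fieldType) (R : algType k) (P : set R) a r :
  ideal P -> P r -> P (a *: r).
Proof. by case=> -[_ _ Pl] _ /(Pl a%:A); rewrite mulr_algl. Qed.

Lemma idealZ_eq (k : fieldType) (R : algType k) (P : set R) a r :
  ideal P -> a != 0 -> P (a *: r) -> P r.
Proof.
by move=> P_ideal a0 /(idealZ (a^-1) P_ideal); rewrite scalerA mulVf // scale1r.
Qed.

Section SkewDerivation.
Variables (k : fieldType) (R : algType k).
Variables (tau : {lrmorphism R -> R}) (tauV : R -> R) (delta : {linear R -> R}).
Variable q : k.
Hypotheses (q0 : q != 0) (q_root : ~ Defs.root_of_unity q).
Hypotheses (tauK : cancel tau tauV) (tauVK : cancel tauV tau).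
Hypothesis skew : forall r, delta (tau r) = q *: tau (delta r).
Hypothesis deltaM : forall r r', delta (r * r') = tau r * delta r' + delta r * r'.
Hypothesis nilp : forall r, exists l, iter l delta r = 0.

Lemma iter_morph (T : Type) (f g : T -> T) l :
  (forall r, f (g r) = g (f r)) -> forall r, iter l f (g r) = g (iter l f r).
Proof. by move=> fg r; elim: l => //= l ->; rewrite fg. Qed.

Lemma iter_linear (f : R -> R) l a u v :
  (forall b x y, f (b *: x + y) = b *: f x + f y) ->
  iter l f (a *: u + v) = a *: iter l f u + iter l f v.
Proof. by move=> fl; elim: l => //= l ->; rewrite fl. Qed.

Lemma tauV_linear a u v : tauV (a *: u + v) = a *: tauV u + tauV v.
Proof. by apply: (can_inj tauK); rewrite linearP /= !tauVK. Qed.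

Lemma tauVM u v : tauV (u * v) = tauV u * tauV v.
Proof. by apply: (can_inj tauK); rewrite rmorphM /= !tauVK. Qed.

Lemma iter_tauVM l u v : iter l tauV (u * v) = iter l tauV u * iter l tauV v.
Proof. by elim: l => //= l ->; rewrite tauVM. Qed.

Lemma iter_tauV0 l : iter l tauV 0 = 0.
Proof. by apply: iter_fix; apply: (can_inj tauK); rewrite tauVK linear0. Qed.

Lemma iter_tauVZ l a u : iter l tauV (a *: u) = a *: iter l tauV u.
Proof. by have := iter_linear l a u 0 tauV_linear; rewrite iter_tauV0 !addr0. Qed.

Lemma iter_tauZ l a u : iter l tau (a *: u) = a *: iter l tau u.
Proof. by elim: l => //= l ->; rewrite linearZ. Qed.

Lemma iter_deltaZ l a u : iter l delta (a *: u) = a *: iter l delta u.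
Proof. by elim: l => //= l ->; rewrite linearZ. Qed.

Lemma iter_delta0 l : iter l delta 0 = 0.
Proof. by apply: iter_fix; rewrite linear0. Qed.

Lemma tau_iterV l r : iter l tau (iter l tauV r) = r.
Proof. by elim: l r => // l IH r; rewrite iterSr iterS tauVK. Qed.

Lemma delta_iter_tau l r : delta (iter l tau r) = q ^+ l *: iter l tau (delta r).
Proof.
elim: l => [|l IH] /=; first by rewrite expr0 scale1r.
by rewrite skew IH linearZ scalerA exprS.
Qed.

Lemma iter_delta_tau i j r :
  iter i delta (iter j tau r) = q ^+ (i * j) *: iter j tau (iter i delta r).
Proof.
elim: i => [|i IH] /=; first by rewrite mul0n expr0 scale1r.
by rewrite IH linearZ /= delta_iter_tau scalerA -exprD mulSn addnC.
Qed.

Lemma iter_tauV_delta i j r :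
  iter j tauV (iter i delta r) = q ^+ (i * j) *: iter i delta (iter j tauV r).
Proof.
rewrite -[r in LHS](tau_iterV j) iter_delta_tau iter_tauVZ; congr (_ *: _).
by elim: j (iter i delta _) => // j IH r'; rewrite iterSr iterS tauK.
Qed.

Definition delta_tauV l r := iter l delta (iter l tauV r).
Local Notation E := delta_tauV.

Lemma delta_tauV_linear l a u v : E l (a *: u + v) = a *: E l u + E l v.
Proof.
by rewrite /E (iter_linear _ _ _ _ tauV_linear) iter_linear //; apply: linearP.
Qed.

Lemma delta_tauV_comp l i r : E l (E i r) = q ^+ (i * l) *: E (l + i) r.
Proof.
rewrite /E iter_tauV_delta iter_deltaZ; congr (_ *: _).
by rewrite -!iterD.
Qed.

Lemma delta_tauV_tau l r : E l (tau r) = q ^+ l *: tau (E l r).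
Proof.
rewrite /E (@iter_morph _ tauV tau) => [|u]; last by rewrite tauK tauVK.
by rewrite -/(iter 1 tau _) iter_delta_tau muln1.
Qed.

Lemma tau_delta_tauVS l r : q ^+ l.+1 *: tau (E l.+1 r) = delta (E l r).
Proof.
rewrite -delta_tauV_tau /E [iter l.+1 tauV _]iterSr tauK.
by [].
Qed.

Definition nil_order N r := iter N delta r = 0.

Lemma nil_orderW N M r : (N <= M)%N -> nil_order N r -> nil_order M r.
Proof. by move=> NM rN; rewrite /nil_order -(subnK NM) iterD rN iter_delta0. Qed.

(** Moving [tauV] past [delta] costs only a nonzero power of [q], so [E l r] vanishes with
    [iter l delta r]. *)
Lemma nil_order_delta_tauV N l r : nil_order N r -> (N <= l)%N -> E l r = 0.
Proof.
move=> rN Nl; apply: (scalerI (expf_neq0 (l * l) q0)).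
rewrite -iter_tauV_delta scaler0 (nil_orderW Nl rN).
exact: iter_tauV0.
Qed.

Lemma nil_order_iter_tauV N l r : nil_order N r -> nil_order N (iter l tauV r).
Proof.
move=> rN; apply: (scalerI (expf_neq0 (N * l) q0)).
rewrite -iter_tauV_delta scaler0 rN.
exact: iter_tauV0.
Qed.

Lemma nil_order_tau N r : nil_order N r -> nil_order N (tau r).
Proof.
by move=> rN; rewrite /nil_order -/(iter 1 tau r) iter_delta_tau rN /= linear0 scaler0.
Qed.

Lemma nil_order_delta_tauV_id N l r : nil_order N r -> nil_order N (E l r).
Proof.
move=> rN; rewrite /nil_order /E -iterD addnC iterD.
by rewrite (nil_order_iter_tauV l rN) iter_delta0.
Qed.

Lemma nil_orderD N r r' a : nil_order N r -> nil_order N r' -> nil_order N (a *: r + r').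
Proof.
move=> rN rN'; rewrite /nil_order iter_linear; last exact: linearP.
by rewrite rN rN' scaler0 addr0.
Qed.

Lemma common_nil_order r r' : exists N, nil_order N r /\ nil_order N r'.
Proof.
have [N rN] := nilp r; have [M rM] := nilp r'; exists (maxn N M).
by split; [apply: nil_orderW rN | apply: nil_orderW rM]; rewrite (leq_maxl, leq_maxr).
Qed.

(** The divided powers of [delta]: they absorb the q-binomial coefficients of the q-Leibniz rule. *)
Definition divided_delta l r := (qfact q l)^-1 *: iter l delta r.
Local Notation D := divided_delta.

Lemma delta_divided l r : delta (D l r) = qnat q l.+1 *: D l.+1 r.
Proof.
rewrite /D linearZ /= scalerA qfactS invfM mulrCA mulfV ?mulr1 //.
exact: qnat_neq0.
Qed.

Lemma divided_deltaM n a b :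
  D n (a * b) = \sum_(i < n.+1) iter (n - i) tau (D i a) * D (n - i) b.
Proof.
elim: n => [|n IH].
  by rewrite big_ord1 /D /= qfact0 invr1 !scale1r.
have qn := qnat_neq0 q_root n; apply: (scalerI qn).
rewrite -delta_divided IH linear_sum /=.
(* Applying [delta] to the term [i] of order [n] feeds the terms [i] and [i + 1] of order [n + 1].
   Regrouped, the term [i] gets [[n + 1 - i] + q ^ (n + 1 - i) [i] = [n + 1]], which is [qnatD]. *)
transitivity (
  \sum_(i < n.+2) qnat q (n.+1 - i) *: (iter (n.+1 - i) tau (D i a) * D (n.+1 - i) b) +
  \sum_(i < n.+2) (q ^+ (n.+1 - i) * qnat q i) *:
     (iter (n.+1 - i) tau (D i a) * D (n.+1 - i) b)).
  rewrite [X in _ = X + _]big_ord_recr [X in _ = _ + X]big_ord_recl /=.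
  rewrite subnn qnat0 mulr0 !scale0r add0r addr0 -big_split /=.
  apply: eq_bigr => i _; have iN : (i <= n)%N by rewrite -ltnS.
  rewrite deltaM delta_divided (subSn iN) /bump leq0n add1n subSS.
  congr (_ + _); first by rewrite -scalerAr.
  by rewrite delta_iter_tau delta_divided iter_tauZ scalerA scalerAl.
rewrite -big_split scaler_sumr; apply: eq_bigr => i _ /=.
by rewrite -scalerDl -qnatD subnKC // -ltnS.
Qed.

Lemma iter_delta_divided l r : iter l delta r = qfact q l *: D l r.
Proof. by rewrite /D scalerA mulfV ?qfact_neq0 // scale1r. Qed.

Lemma divided_delta_nil_order N l r : nil_order N r -> (N <= l)%N -> D l r = 0.
Proof. by move=> rN Nl; rewrite /D (nil_orderW Nl rN) scaler0. Qed.

Lemma nil_orderM N a b : nil_order N a -> nil_order N b -> nil_order (N + N) (a * b).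
Proof.
move=> aN bN; rewrite /nil_order iter_delta_divided divided_deltaM.
rewrite big1 ?scaler0 // => i _.
have [Ni|iN] := leqP N i.
  rewrite (divided_delta_nil_order aN Ni) iter_fix ?mul0r ?linear0 //.
by rewrite [D _ b](divided_delta_nil_order bN) ?mulr0 //; lia.
Qed.

(** The q-Leibniz rule, rescaled: the cross term of [cauchon_coefD] is exactly the factor needed to
    exchange [iter i delta] and [iter j tau] in front of [a]. This is the degree [-n] part of the
    multiplicativity of [C]. *)
Lemma cauchon_coef_delta_tauVM n a b :
  cauchon_coef q n *: E n (a * b) =
  \sum_(i < n.+1) (cauchon_coef q i * cauchon_coef q (n - i)) *:
    (E i a * E (n - i) (iter i tauV b)).
Proof.
rewrite {1}/E iter_tauVM iter_delta_divided divided_deltaM scalerA scaler_sumr.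
apply: eq_bigr => i _; have := subnKC (ltn_ord i : (i <= n)%N).
move: (nat_of_ord i) (n - i)%N => {}i j <-; rewrite cauchon_coefD //.
have -> : E i a = q ^+ (i * j) *: iter j tau (iter i delta (iter (i + j) tauV a)).
  by rewrite -iter_delta_tau addnC iterD tau_iterV.
have -> : E j (iter i tauV b) = iter j delta (iter (i + j) tauV b).
  by rewrite /E -iterD addnC.
rewrite /D iter_tauZ -!scalerAl -!scalerAr !scalerA; congr (_ *: _).
by field; rewrite !qfact_neq0.
Qed.

(** * The largest [delta]-stable ideal inside an ideal *)

Section DeltaCore.
Variable P : set R.
Hypotheses (P_ideal : ideal P) (P_tau : forall r, P r -> P (tau r)).
Hypothesis P_tauV : forall r, P r -> P (tauV r).

Definition delta_core : set R := [set r | forall l, P (iter l delta r)].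

Let PZ a r : P r -> P (a *: r).
Proof. exact: idealZ. Qed.

Let PZE a r : a != 0 -> P (a *: r) -> P r.
Proof. exact: idealZ_eq. Qed.

Let P_iter_tau l r : P r -> P (iter l tau r).
Proof. by move=> Pr; elim: l => //= l; apply: P_tau. Qed.

Let P_iter_tauV l r : P r -> P (iter l tauV r).
Proof. by move=> Pr; elim: l => //= l; apply: P_tauV. Qed.

Lemma delta_coreE r : delta_core r <-> forall l, P (E l r).
Proof.
split=> Pr l; have := Pr l.
  move=> /(P_iter_tauV l); rewrite iter_tauV_delta.
  by apply: PZE; rewrite expf_neq0.
move=> /(PZ (q ^+ (l * l))); rewrite -iter_tauV_delta => /(P_iter_tau l).
by rewrite tau_iterV.
Qed.

Lemma delta_core_sub : delta_core `<=` P.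
Proof. by move=> r /(_ 0). Qed.

Lemma delta_core_delta r : delta_core r -> delta_core (delta r).
Proof. by move=> Pr l; rewrite -iterSr; apply: Pr. Qed.

Lemma sub_delta_core (I : set R) :
  I `<=` P -> (forall r, I r -> I (delta r)) -> I `<=` delta_core.
Proof. by move=> IP Id r Ir l; apply: IP; elim: l => //= l; apply: Id. Qed.

Lemma delta_core_morph (h : {lrmorphism R -> R}) c r :
    c != 0 -> (forall u, h (delta u) = c *: delta (h u)) ->
    (forall u, P u -> P (h u)) -> delta_core r -> delta_core (h r).
Proof.
move=> c0 hdelta Ph Pr l; have [cl E] : c ^+ l != 0 /\
    h (iter l delta r) = c ^+ l *: iter l delta (h r).
  split; first exact: expf_neq0.
  elim: l => [|l /= IH]; first by rewrite expr0 scale1r.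
  by rewrite hdelta IH linearZ scalerA exprS.
by apply: (PZE cl); rewrite -E; apply: Ph.
Qed.

(** Peeling one [delta] off a product gives two products of the same shape, still with a factor in
    the core; the induction on [l] therefore generalises over both factors. *)
Lemma delta_core_ideal : ideal delta_core.
Proof.
case: (P_ideal) => -[P0 PD Pl] [_ _ Pr].
have core0 : delta_core 0 by move=> l; rewrite iter_delta0.
have coreD a b : delta_core a -> delta_core b -> delta_core (a + b).
  move=> Pa Pb l; rewrite -(scale1r a) iter_linear; last exact: linearP.
  by rewrite scale1r; apply: PD.
have core_tau a : delta_core a -> delta_core (tau a).
  move=> Pa l; rewrite -/(iter 1 tau a) iter_delta_tau.
  by apply/PZ/P_tau/Pa.
have iterD0 l a b : iter l delta (a + b) = iter l delta a + iter l delta b.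
  by rewrite -(scale1r a) iter_linear ?scale1r //; apply: linearP.
split; split=> // c a Pa l.
  elim: l c a Pa => [|l IH] c a Pa; first exact/Pl/(Pa 0).
  rewrite iterSr deltaM iterD0; apply: PD; last exact: IH.
  exact/IH/delta_core_delta.
elim: l c a Pa => [|l IH] c a Pa; first exact/Pr/(Pa 0).
rewrite iterSr deltaM iterD0; apply: PD; first exact/IH/core_tau.
exact/IH/delta_core_delta.
Qed.

(** By local nilpotence and [0 \in P], the exponents [l] with [iter l delta a] outside [P] are
    bounded, so a largest one exists. *)
Lemma last_iter_delta_notin a :
    ~ delta_core a ->
  exists2 i, ~ P (iter i delta a) & forall l, (i < l)%N -> P (iter l delta a).
Proof.
move=> aP; have [N aN] := nilp a; have P0 : P 0 by case: P_ideal => -[].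
have ex : exists l, `[< ~ P (iter l delta a) >].
  by have /existsNP[l ?] := aP; exists l; apply/asboolP.
have bound l : `[< ~ P (iter l delta a) >] -> (l <= N)%N.
  move=> /asboolP Pl; rewrite leqNgt; apply/negP => /ltnW Nl.
  by apply: Pl; rewrite (nil_orderW Nl aN).
exists (ex_maxn ex bound); case: ex_maxnP => i /asboolP // _ imax l il.
by apply: contrapT => /asboolP /imax; rewrite leqNgt il.
Qed.

(* In the q-Leibniz expansion of [delta ^ (i + j) (a b)], where [i] and [j] are
   maximal with [delta ^ i a] and [delta ^ j b] outside [P], only one term is
   not in [P]. *)
Lemma delta_core_completely_prime :
  completely_prime_ideal P -> completely_prime_ideal delta_core.
Proof.
move=> [_ PT Pprime]; split; first exact: delta_core_ideal.
  move=> coreT; apply: PT; apply/seteqP; split=> // r _.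
  by apply: delta_core_sub; rewrite coreT.
have [[P0 PD Pl] [_ _ Pr]] := P_ideal.
move=> a b Pab; apply: contrapT => /not_orP[/last_iter_delta_notin[i aP aPi]].
move=> /last_iter_delta_notin[j bP bPj].
have PDl m r : P (iter m delta r) -> P (D m r) by move=> ?; apply: PZ.
have PDlE m r : P (D m r) -> P (iter m delta r) by rewrite iter_delta_divided; apply: PZ.
have : P (D (i + j) (a * b)) by apply: PDl; apply: Pab.
have iij : (i < (i + j).+1)%N by rewrite ltnS leq_addr.
rewrite divided_deltaM (bigD1 (Ordinal iij)) //= addKn.
set y := \sum_(_ < _ | _) _; have Py : P y.
  apply: big_ind => // m mi.
  have [lt_im|] := ltnP i m; first exact/Pr/P_iter_tau/PDl/aPi.
  rewrite leq_eqVlt => /orP[/eqP mE|lt_mi]; last by apply/Pl/PDl/bPj; lia.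
  by case/eqP: mi; apply: val_inj.
move=> /PD/(_ (PZ (-1) Py)); rewrite scaleN1r addrK => /Pprime[|/PDlE//].
move=> /(P_iter_tauV j); have -> r : iter j tauV (iter j tau r) = r.
  by elim: j {bP bPj Pab iij y Py} r => // j IH r; rewrite iterSr iterS tauK.
by move=> /PDlE.
Qed.

End DeltaCore.

(** * Cauchon's map as a ring morphism, and its inverse expansion *)

Variables (L : unitAlgType k) (rho : {lrmorphism R -> L}) (X : L).
Hypothesis X_unit : X \is a GRing.unit.
Hypothesis X_comm : forall r, X * rho r = rho (tau r) * X + rho (delta r).

Local Notation cf := (cauchon_coef q).
Local Notation C := (cauchon_map rho id tauV delta X q).

Let rhoZ a r : rho (a *: r) = a *: rho r.
Proof. by rewrite linearZ. Qed.

Lemma cauchon_map_trunc N r : nil_order N r ->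
  C r = \sum_(l < N) cf l *: (rho (E l r) * X ^- l).
Proof.
move=> rN; rewrite (fsbig_ord +%R N (fun l => cf l *: (rho (E l r) * X ^- l))).
apply/esym; apply: fsbig_widen => // l [_ /= /negP]; rewrite -leqNgt => Nl.
by rewrite -/(E l r) (nil_order_delta_tauV rN Nl) rmorph0 mul0r scaler0.
Qed.

Lemma cauchon_map_linear a u v : C (a *: u + v) = a *: C u + C v.
Proof.
have [N [uN vN]] := common_nil_order u v.
rewrite !(@cauchon_map_trunc N) //; last exact: nil_orderD.
rewrite scaler_sumr -big_split; apply: eq_bigr => l _ /=.
rewrite (delta_tauV_linear) rmorphD /= mulrDl scalerDr.
by rewrite rhoZ -scalerAl !scalerA [a * _]mulrC.
Qed.

Lemma cauchon_map0 : C 0 = 0.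
Proof. by rewrite (@cauchon_map_trunc 0) // big_ord0. Qed.

Lemma cauchon_mapZ a u : C (a *: u) = a *: C u.
Proof. by have := cauchon_map_linear a u 0; rewrite cauchon_map0 !addr0. Qed.

Lemma cauchon_map_twist r : X * C r = C (tau r) * X.
Proof.
have [N rN] := nilp r; have trN := nil_order_tau rN.
rewrite !(@cauchon_map_trunc N) // mulr_sumr mulr_suml.
have XVl l : X * X ^- l = X ^- l * X.
  by apply: commrV; apply: commrX.
(* The term [l] of the difference of both sides is [f l - f l.+1]. At the ends, [f 0 = 0] because of
   the factor [1 - q ^+ 0], and [f N = 0] because [E N r = 0]. *)
pose f l := ((1 - q ^+ l) * cf l) *: (rho (tau (E l r)) * X ^- l * X).
apply/eqP; rewrite -subr_eq0 -sumrB.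
rewrite (eq_bigr (fun l : 'I_N => - (f l.+1 - f l))) => [|l _].
  rewrite sumrN -(big_mkord xpredT (fun l => f l.+1 - f l)) telescope_sumr //.
  rewrite /f expr0 subrr mul0r scale0r subr0.
  rewrite (nil_order_delta_tauV rN (leqnn N)).
  by rewrite linear0 rmorph0 !mul0r scaler0 oppr0.
rewrite (delta_tauV_tau) linearZ /=.
rewrite -scalerAr !mulrA X_comm mulrDl -[_ * X * X ^- l]mulrA XVl mulrA.
rewrite -!scalerAl scalerA opprB /f.
have -> : (1 - q ^+ l.+1) * cf l.+1 = - (q ^+ l.+1 * cf l).
  by rewrite -cauchon_coefS // -mulrN opprB mulrC.
rewrite -[_ / X ^+ l.+1 * X]mulrA.
have -> : X ^- l.+1 * X = X ^- l by rewrite exprS invrM ?unitrX // mulrVK.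
have Edelta : q ^+ l.+1 *: (rho (tau (E l.+1 r)) / X ^+ l) = rho (delta (E l r)) / X ^+ l.
  by rewrite scalerAl -rhoZ (tau_delta_tauVS).
rewrite scaleNr opprK [q ^+ l.+1 * _]mulrC -[(_ * q ^+ l.+1) *: _]scalerA Edelta.
rewrite scalerDr addrAC -scalerBl.
by congr (_ *: _ + _); ring.
Qed.

Lemma cauchon_map_twistV l r : X ^- l * C r = C (iter l tauV r) * X ^- l.
Proof.
have twist1 u : X^-1 * C u = C (tauV u) * X^-1.
  apply: (mulrI X_unit); rewrite !mulrA cauchon_map_twist tauVK mulrV //.
  by rewrite mul1r mulrK.
rewrite -!exprVn; elim: l r => [|l IH] r; first by rewrite mulr1 mul1r.
by rewrite exprS -mulrA IH mulrA twist1 -mulrA.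
Qed.

Lemma cauchon_map1 : C 1 = 1.
Proof.
have [N N1] := nilp 1; have delta1 : delta 1 = 0.
  apply: (addIr (delta 1)).
  by rewrite add0r -[in RHS](mulr1 1) deltaM rmorph1 mul1r mulr1.
rewrite (@cauchon_map_trunc 1) // big_ord1 cauchon_coef0 scale1r /= rmorph1.
by rewrite invr1 mulr1.
Qed.

Lemma cauchon_mapM a b : C (a * b) = C a * C b.
Proof.
have [N [aN bN]] := common_nil_order a b.
(* The term of [C a * C b] of bidegree [(i, j)], once [X ^- i] has been moved to the right of [C b]
   by [cauchon_map_twistV]. *)
pose F i j := (cf i * cf j) *: (rho (E i a * E j (iter i tauV b)) * X ^- (i + j)).
rewrite (cauchon_map_trunc (nil_orderM aN bN)).
transitivity (\sum_(n < N + N) \sum_(i < n.+1) F i (n - i)%N).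
  apply: eq_bigr => n _; rewrite scalerAl -rhoZ.
  rewrite (cauchon_coef_delta_tauVM).
  rewrite rmorph_sum mulr_suml; apply: eq_bigr => i _.
  by rewrite /F subnKC -1?ltnS //= rhoZ scalerAl.
rewrite (@sum_antidiagonal _ F) => [|i j].
  rewrite (cauchon_map_trunc aN) mulr_suml; apply: eq_bigr => i _.
  rewrite -scalerAl -mulrA cauchon_map_twistV.
  rewrite (cauchon_map_trunc (nil_order_iter_tauV i bN)).
  rewrite mulr_suml mulr_sumr scaler_sumr; apply: eq_bigr => j _.
  rewrite /F -scalerAl -scalerAr scalerA; congr (_ *: _).
  by rewrite rmorphM -!mulrA exprD invrM ?unitrX.
rewrite /F; case/orP => [iN|jN].
  rewrite (nil_order_delta_tauV aN iN).
  by rewrite mul0r rmorph0 mul0r scaler0.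
have tbN := nil_order_iter_tauV i bN.
rewrite (nil_order_delta_tauV tbN jN).
by rewrite mulr0 rmorph0 mul0r scaler0.
Qed.

(** Since [E j (E i r) = q ^ (i j) E (i + j) r], expanding each [C (E i r)] and collecting by
    [n = i + j] leaves the sums of [inverse_coefE], which vanish except for [n = 0]. *)
Lemma inverse_cauchon_map N r : nil_order N r ->
  \sum_(l < N) inverse_coef q l *: (C (E l r) * X ^- l) = rho r.
Proof.
move=> rN.
pose F i j :=
  (inverse_coef q i * cf j * q ^+ (i * j)) *: (rho (E (i + j) r) * X ^- (i + j)).
have F0 i j : (N <= i)%N || (N <= j)%N -> F i j = 0.
  move=> Nij; rewrite /F (nil_order_delta_tauV rN).
    by rewrite rmorph0 mul0r scaler0.
  by case/orP: Nij => ?; lia.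
transitivity (\sum_(i < N) \sum_(j < N) F i j).
  apply: eq_bigr => i _.
  rewrite (cauchon_map_trunc (nil_order_delta_tauV_id i rN)).
  rewrite mulr_suml scaler_sumr; apply: eq_bigr => j _.
  rewrite (delta_tauV_comp) rhoZ -!scalerAl !scalerA /F addnC.
  by rewrite -[rho _ / _ / _]mulrA -invrM ?unitrX // -exprD mulrA.
transitivity (\sum_(n < N + N) \sum_(i < n.+1) F i (n - i)%N).
  by symmetry; apply: sum_antidiagonal.
transitivity (\sum_(n < N + N) (n == 0 :> nat)%:R *: (rho (E n r) * X ^- n)).
  apply: eq_bigr => n _; rewrite -(inverse_coefE q0 q_root) scaler_suml.
  by apply: eq_bigr => i _; rewrite /F subnKC // -ltnS.
case: N rN {F0} => [r0|N rN].
  by rewrite big_ord0; move: r0; rewrite /nil_order /= => ->; rewrite rmorph0.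
rewrite addSn big_ord_recl big1 => [|i _]; last by rewrite /= scale0r.
by rewrite scale1r addr0 /= invr1 mulr1.
Qed.

Local Notation Q := (skew_eval rho X).

Hypothesis rho_free : forall p : {poly R}, Q p = 0 -> p = 0.
Hypothesis rho_gen :
  forall y, exists (p : {poly R}) e, y * X ^+ e = Q p.

Lemma cauchon_map_zmod_morphism : zmod_morphism C.
Proof.
move=> u v; rewrite -[u - v]addrC -scaleN1r.
by rewrite (cauchon_map_linear) scaleN1r addrC.
Qed.

Lemma cauchon_map_monoid_morphism : monoid_morphism C.
Proof.
split; first exact: (cauchon_map1).
exact: (cauchon_mapM).
Qed.

Let Cm : {rmorphism R -> L} := HB.pack C
  (GRing.isZmodMorphism.Build R L C cauchon_map_zmod_morphism)
  (GRing.isMonoidMorphism.Build R L C cauchon_map_monoid_morphism).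

Local Notation T := (skew_eval Cm X).

(* [y], as a Laurent series in [X^-1] with coefficients in [rho R], has degree
   less than [d]. *)
Definition degree_lt d y :=
  exists (p : {poly R}) M, y * X ^+ M = Q p /\ forall i, (d + M <= i)%N -> p`_i = 0.

Lemma degree_ltD d y z : degree_lt d y -> degree_lt d z -> degree_lt d (y + z).
Proof.
move=> [p [M [yE pd]]] [p' [M' [zE p'd]]]; exists (p * 'X^M' + p' * 'X^M), (M + M')%N.
rewrite mulrDl skew_evalD !skew_evalMXn -yE -zE -!mulrA -!exprD [(M' + M)%N]addnC.
split=> // i id; rewrite coefD !coefMXn.
case: ifP => [|_]; first lia; case: ifP => [|_]; first lia.
by rewrite pd ?p'd ?addr0 //; lia.
Qed.

Lemma degree_ltMX d y : degree_lt d y -> degree_lt d.+1 (y * X).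
Proof.
move=> [p [M [yE pd]]]; exists (p * 'X), M.
rewrite skew_evalMX -yE -!mulrA -exprS -exprSr.
by split=> // -[|i] /= di; rewrite coefMX /= ?pd //; lia.
Qed.

Lemma cauchon_map_rho N c : nil_order N c ->
  C c * X ^+ N = Q (\poly_(i < N.+1) (cf (N - i) *: E (N - i) c)).
Proof.
move=> cN; rewrite (skew_eval_poly_rev _ X_unit (fun l => cf l *: E l c)).
rewrite (cauchon_map_trunc (nil_orderW (leqnSn N) cN)) mulr_suml.
by apply: eq_bigr => l _; rewrite /= rhoZ -!scalerAl.
Qed.

Lemma rho_cauchon_map N r : nil_order N r ->
  rho r * X ^+ N = T (\poly_(i < N.+1) (inverse_coef q (N - i) *: E (N - i) r)).
Proof.
move=> rN; rewrite (skew_eval_poly_rev _ X_unit (fun l => inverse_coef q l *: E l r)).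
rewrite -(inverse_cauchon_map (nil_orderW (leqnSn N) rN)) mulr_suml.
by apply: eq_bigr => l _; rewrite /Cm /= cauchon_mapZ -!scalerAl.
Qed.

Lemma degree_lt_leading c : degree_lt 0 (C c - rho c).
Proof.
have [N cN] := nilp c.
exists (\poly_(i < N.+1) (cf (N - i) *: E (N - i) c) - c%:P * 'X^N), N; split.
  by rewrite mulrBl (cauchon_map_rho cN) skew_evalB skew_evalMXn skew_evalC.
move=> i Ni; rewrite coefB coef_poly coefCM coefXn.
case: (ltngtP i N) => [||->]; [lia| |].
  by move=> iN; rewrite ltnS leqNgt iN mulr0 subrr.
by rewrite ltnSn subnn cauchon_coef0 scale1r mulr1 subrr.
Qed.

Lemma degree_ltW d d' y : (d <= d')%N -> degree_lt d y -> degree_lt d' y.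
Proof. by move=> dd' [p [M [yE pd]]]; exists p, M; split=> // i ?; apply: pd; lia. Qed.

(** Each [C c] is [rho c] plus terms of negative degree, so [T p] and [Q p] share their leading
    term. The injectivity of [T] then follows from that of [Q]. *)
Lemma skew_eval_cauchon_leading (p : {poly R}) d :
  (size p <= d.+1)%N -> degree_lt d (T p - Q p).
Proof.
elim/poly_ind: p d => [|p c IH] d.
  rewrite !skew_eval0 subrr => _; exists 0, 0%N; rewrite mul0r skew_eval0.
  by split=> // i _; rewrite coef0.
rewrite !skew_evalD !skew_evalMX !skew_evalC opprD addrACA -mulrBl => sz.
have [p0|p0] := eqVneq p 0.
  rewrite p0 !skew_eval0 subrr mul0r add0r; apply: (degree_ltW (leq0n d)).
  exact: degree_lt_leading.
move: sz; rewrite size_MXaddC (negbTE p0) /= ltnS; case: d => [|d].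
  by rewrite leqn0 size_poly_eq0 (negbTE p0).
move=> /IH pd; apply: degree_ltD; first exact: degree_ltMX.
by apply: (degree_ltW (leq0n d.+1)); apply: degree_lt_leading.
Qed.

Lemma skew_eval_cauchon_inj p : T p = 0 -> p = 0.
Proof.
move=> Tp0; apply/eqP/negPn/negP => p0.
have szp : (0 < size p)%N by rewrite size_poly_gt0.
have := @skew_eval_cauchon_leading p (size p).-1.
rewrite prednK // Tp0 sub0r => /(_ (leqnn _)) [p' [M [pE p'd]]].
have /rho_free pp0 : Q (p' + p * 'X^M) = 0.
  by rewrite skew_evalD skew_evalMXn -pE mulNr addNr.
have := coefD p' (p * 'X^M) ((size p).-1 + M).
rewrite pp0 coef0 p'd // add0r coefMXn ltnNge leq_addl /= addnK => /esym/eqP.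
by rewrite -/(lead_coef p) lead_coef_eq0 (negbTE p0).
Qed.

Lemma skew_eval_cauchon_gen y : exists (p : {poly R}) e, y * X ^+ e = T p.
Proof.
have gen_rho p : exists (p' : {poly R}) e, Q p * X ^+ e = T p'.
  elim/poly_ind: p => [|p c [p' [e p'E]]].
    by exists 0, 0%N; rewrite !skew_eval0 mul0r.
  have [N cN] := nilp c.
  (* The exponent [e] clears the denominators of [Q p] over [C], and [N] those of the expansion of
     [rho c]. *)
  exists (p' * 'X^(1 + N) +
    \poly_(i < N.+1) (inverse_coef q (N - i) *: E (N - i) c) * 'X^e), (e + N)%N.
  rewrite skew_evalD [RHS]skew_evalD !skew_evalMXn -p'E -rho_cauchon_map //.
  rewrite skew_evalMX skew_evalC mulrDl -!mulrA -!exprD -exprS.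
  by congr (_ * _ ^+ _ + _ * _ ^+ _); lia.
have [p [e yE]] := rho_gen y; have [p' [e' p'E]] := gen_rho p.
by exists p', (e + e')%N; rewrite exprD mulrA yE p'E.
Qed.

(** By the inverse expansion, [rho r] has a numerator over [C] whose coefficients are nonzero
    multiples of the [E l r]; they all lie in [P] exactly when [r] is in the core. *)
Lemma cauchon_ideal_contraction (P : set R) r :
    ideal P -> (forall u, P u -> P (tau u)) -> (forall u, P u -> P (tauV u)) ->
  ideal_gen (C @` P) (rho r) <-> delta_core P r.
Proof.
move=> P_ideal P_tau P_tauV.
have [N rN] := nilp r; have P0 : P 0 by case: P_ideal => -[].
have := @laurent_ideal_gen _ _ Cm _ _ _ tauK tauVK X_unit cauchon_map_twist
  skew_eval_cauchon_inj skew_eval_cauchon_gen _ P_ideal P_tau P_tauV _ _ _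
  (rho_cauchon_map rN).
move=> ->; rewrite (delta_coreE P_ideal P_tau P_tauV); split=> [Pr l|Pr i].
  have [Nl|lN] := leqP N l; first by rewrite (nil_order_delta_tauV rN Nl).
  have := Pr (N - l)%N; rewrite coef_poly ltnS leq_subr subKn 1?ltnW //.
  by apply: idealZ_eq; last exact: inverse_coef_neq0.
by rewrite coef_poly; case: ifP => // _; apply: idealZ.
Qed.

End SkewDerivation.

(** * Contraction of the ideal generated by [P] and [x] *)

Section ExtendX.
Variables (k : fieldType) (R S : algType k) (iota : {lrmorphism R -> S}).
Variables (tau delta : R -> R) (x : S).
Hypothesis x_comm : forall r, x * iota r = iota (tau r) * x + iota (delta r).

Local Notation Q := (skew_eval iota x).

Hypothesis Q_inj : injective Q.
Hypothesis Q_surj : forall y, exists p : {poly R}, y = Q p.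
Variable P : set R.
Hypotheses (P_ideal : ideal P) (delta_P : range delta `<=` P).

Lemma extend_x_contraction : contraction iota (extend_x iota x P) = P.
Proof.
have [[P0 PD Pl] [_ _ Pr]] := P_ideal.
apply/seteqP; split=> [r|r Pr' I [_ I_P]]; last by apply: I_P; left; exists r.
(* The set [iota P + S x] is a two-sided ideal because moving [x] past [iota r] only creates
   [iota (delta r)] with [delta r] in [P]. Its elements have constant coefficient in [P]. *)
pose K : set S := [set y | exists r z, P r /\ y = iota r + z * x].
have KD y y' : K y -> K y' -> K (y + y').
  move=> [u [z [Pu ->]]] [u' [z' [Pu' ->]]]; exists (u + u'), (z + z').
  by rewrite rmorphD mulrDl addrACA; split=> //; apply: PD.
have KP u : P u -> K (iota u) by move=> Pu; exists u, 0; rewrite mul0r addr0.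
have K0 : K 0 by exists 0, 0; rewrite rmorph0 mul0r addr0.
have Kx y : K (y * x) by exists 0, y; rewrite rmorph0 add0r.
have KQ (p : {poly R}) u : P u -> K (Q p * iota u).
  elim/poly_ind: p u => [|p c IH] u Pu; first by rewrite skew_eval0 mul0r.
  rewrite skew_evalD skew_evalMX skew_evalC mulrDl -rmorphM -mulrA x_comm mulrDr mulrA.
  apply: (KD _ _); last exact/KP/Pl.
  by apply: (KD _ _ (Kx _)); apply: IH; apply: delta_P; exists u.
have Kl y u : K u -> K (y * u).
  move=> [v [z [Pv ->]]]; have [p ->] := Q_surj y.
  by rewrite mulrDr mulrA; exact: (KD _ _ (KQ _ _ Pv) (Kx _)).
have Kr u y : K y -> K (y * u).
  have [p ->] := Q_surj u; elim/poly_ind: p => [|p c IH] Ky.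
    by rewrite skew_eval0 mulr0.
  rewrite skew_evalD skew_evalMX skew_evalC mulrDr mulrA; apply: (KD _ _ (Kx _)).
  case: Ky => v [z [Pv ->]]; rewrite mulrDl -rmorphM -mulrA x_comm mulrDr mulrA.
  apply: (KD _ _); first exact/KP/Pr.
  by apply: (KD _ _ (Kx _)); apply/Kl/KP/delta_P; exists c.
have K_ideal : ideal K by split; split.
case/(_ K) => [|v [z [Pv vE]]].
  by split=> // _ [[v Pv <-]|->]; [exact: KP|rewrite -(mul1r x)].
have [p zE] := Q_surj z; suff -> : r = v by [].
have /Q_inj /polyP /(_ 0) : Q r%:P = Q (p * 'X + v%:P).
  by rewrite skew_evalD skew_evalMX !skew_evalC -zE addrC.
by rewrite coefD coefMX !coefC /= add0r.
Qed.

End ExtendX.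

(** * Lifting property of the Bruhat order *)

Section ReflectionCocycle.
Variable W : groupType.
Local Open Scope group_scope.

(* Semidirect product of the functions [W -> bool], under pointwise addition
   modulo 2, by [W] acting by conjugation. *)
Definition twisted_functions : Type := ((W -> bool) * W)%type.

HB.instance Definition _ := gen_eqMixin twisted_functions.
HB.instance Definition _ := gen_choiceMixin twisted_functions.

Definition twisted_one : twisted_functions := (fun=> false, 1).
Definition twisted_inv (x : twisted_functions) : twisted_functions :=
  (fun r => x.1 (r ^ x.2^-1), x.2^-1).
Definition twisted_mul (x y : twisted_functions) : twisted_functions :=
  (fun r => x.1 r (+) y.1 (r ^ x.2), x.2 * y.2).

Lemma twisted_mulA : associative twisted_mul.
Proof.
move=> x y z; rewrite /twisted_mul /= mulgA; congr pair.
by apply/funext => r; rewrite conjgM addbA.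
Qed.

Lemma twisted_mul1 : left_id twisted_one twisted_mul.
Proof.
case=> f u; rewrite /twisted_mul /= mul1g; congr pair.
by apply/funext => r; rewrite conjg1.
Qed.

Lemma twisted_mulr1 : right_id twisted_one twisted_mul.
Proof.
case=> f u; rewrite /twisted_mul /= mulg1; congr pair.
by apply/funext => r; rewrite addbF.
Qed.

Lemma twisted_mulV : left_inverse twisted_one twisted_inv twisted_mul.
Proof.
case=> f u; rewrite /twisted_mul /twisted_one /= mulVg; congr pair.
by apply/funext => r; rewrite addbb.
Qed.

Lemma twisted_mulrV : right_inverse twisted_one twisted_inv twisted_mul.
Proof.
case=> f u; rewrite /twisted_mul /twisted_one /= mulgV; congr pair.
by apply/funext => r; rewrite -conjgM mulgV conjg1 addbb.
Qed.

HB.instance Definition _ := isGroup.Build twisted_functions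
  twisted_mulA twisted_mul1 twisted_mulr1 twisted_mulV twisted_mulrV.

Variables (n : nat) (m : 'I_n -> 'I_n -> nat) (s : 'I_n -> W).
Hypothesis HW : coxeter_group m s.

Lemma coxeter_gen_sq i : s i * s i = 1.
Proof. by case: HW => -[mii _ _] /(_ i i); rewrite mii expg1. Qed.

Definition twisted_gen (i : 'I_n) : twisted_functions :=
  (fun r => r == s i, s i).

(** The elements [(s i * s j) ^+ k * s i], for [k < 2 l], are the reflections attached to the
    alternating word of length [2 l]. *)
Lemma twisted_gen_expg i j l :
  (twisted_gen i * twisted_gen j) ^+ l =
  (fun r => \big[addb/false]_(k < l.*2) (r == (s i * s j) ^+ k * s i),
   (s i * s j) ^+ l) :> twisted_functions.
Proof.
have sV h : (s h)^-1 = s h by rewrite -[LHS]mulg1 -(coxeter_gen_sq h) mulKg.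
set c := s i * s j.
have cV : s i * c^-1 = c * s i by rewrite /c invgM !sV mulgA.
have cVX k : s i * c ^- k = c ^+ k * s i.
  elim: k => [|k IH]; first by rewrite expg0 invg1 mulg1 mul1g.
  by rewrite {1}expgSr invgM mulgA cV -mulgA IH mulgA -expgS.
elim: l => [|l IH].
  by rewrite !expg0; congr pair; apply/funext => r; rewrite big_ord0.
rewrite expgSr {}IH; congr pair; last by rewrite -/c -expgSr.
apply/funext => r /=; rewrite doubleS !big_ord_recr /= -addbA; congr addb.
have conj_eq t : (r ^ (c ^+ l) == t) = (r == c ^+ l * t * c ^- l).
  by rewrite (can2_eq (conjgK _) (conjgKV _)) conjgE invgK mulgA.
have c2 : c ^+ l.*2 = c ^+ l * c ^+ l by rewrite -addnn expgnDr.
congr addb; first by rewrite conj_eq c2 -!mulgA cVX.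
rewrite -conjgM (can2_eq (conjgK _) (conjgKV _)) conjgE invgK invgM sV.
congr (r == _); rewrite expgSr c2 -!mulgA; congr (_ * _).
by rewrite cVX !(mulgA (s i) (s j)) -/c [LHS]mulgA -expgS expgSr -mulgA.
Qed.

(** For [l = m i j] the list of [2 l] reflections repeats after [l] terms, so every reflection
    occurs an even number of times. *)
Lemma twisted_gen_relations : coxeter_relations m twisted_gen.
Proof.
case: HW => _ rel _ i j; rewrite twisted_gen_expg rel; congr pair.
apply/funext => r; rewrite -addnn big_split_ord /=.
under [X in _ (+) X]eq_bigr do rewrite expgnDr rel mul1g.
by rewrite addbb.
Qed.

(* Parity of the number of occurrences of [r] among the reflections attached to
   a word of [u]; reading it off a homomorphism into the semidirect product
   shows that it does not depend on the word. *)
Lemma reflection_cocycle : exists N : W -> W -> bool,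
  (forall u v r, N (u * v) r = N u r (+) N v (r ^ u)) /\
  (forall i r, N (s i) r = (r == s i)).
Proof.
case: (HW) => _ rel univ.
have [phi [[phiM phis] _]] := univ _ _ twisted_gen_relations.
(* The second component of [phi] is an endomorphism fixing the generators, hence the identity by
   uniqueness in the presentation. *)
have phi2 u : (phi u).2 = u.
  have [id' [_ uniq_id]] := univ W s rel.
  have phi_id : id' = fun u => (phi u).2.
    by apply: uniq_id; split=> [x y|i]; rewrite ?phiM ?phis.
  have id_id : id' = id by apply: uniq_id.
  by rewrite -[RHS]/(id u) -id_id phi_id.
exists (fun u r => (phi u).1 r); split=> [u v r|i r]; last by rewrite phis.
by rewrite phiM /= phi2.
Qed.

End ReflectionCocycle.

Section BruhatLifting.
Variables (W : groupType) (n : nat) (m : 'I_n -> 'I_n -> nat) (s : 'I_n -> W).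
Hypothesis HW : coxeter_group m s.
Local Open Scope group_scope.

Local Notation gen_sq := (coxeter_gen_sq HW).

Lemma has_word_exists_length w l : has_word s w l -> exists l', has_length s w l'.
Proof.
move=> wl; have ex : exists l', `[< has_word s w l' >] by exists l; apply/asboolP.
exists (ex_minn ex); case: ex_minnP => l0 /asboolP ? l0_min.
by split=> // l' ?; apply: l0_min; apply/asboolP.
Qed.

Lemma has_length_uniq w l l' : has_length s w l -> has_length s w l' -> l = l'.
Proof.
move=> [wl lmin] [wl' lmin']; apply/eqP.
by rewrite eqn_leq lmin ?lmin'.
Qed.

Lemma has_word_mul_gen w l i : has_word s w l -> has_word s (w * s i) l.+1.
Proof.
case=> e <- ->; exists (rcons e i); first by rewrite size_rcons.
by rewrite -cats1 big_cat big_seq1.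
Qed.

Lemma reflection_gen i : reflection s (s i).
Proof. by exists 1, i; rewrite mul1g invg1 mulg1. Qed.

Lemma reflectionJ t g : reflection s t -> reflection s (t ^ g).
Proof.
by case=> h [i ->]; exists (g^-1 * h), i; rewrite conjgE invgM invgK !mulgA.
Qed.

Section Cocycle.
Variable N : W -> W -> bool.
Hypotheses (NM : forall u v r, N (u * v) r = N u r (+) N v (r ^ u))
           (Ns : forall i r, N (s i) r = (r == s i)).

Lemma cocycle1 r : N 1 r = false.
Proof. by have := NM 1 1 r; rewrite mulg1 conjg1; case: (N 1 r). Qed.

(** For [t = g s_i g^-1], the contributions of [g] and [g^-1] cancel modulo 2, leaving that of [s_i]
    at itself. *)
Lemma cocycle_reflection t : reflection s t -> N t t.
Proof.
case=> g [i tE].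
have tg : t ^ g = s i by rewrite conjgE tE !mulgA mulVg mul1g -mulgA mulVg mulg1.
have := NM g g^-1 t; rewrite mulgV cocycle1 tg => Ng.
rewrite {1}tE !NM Ns tg eqxx.
rewrite conjgM tg conjgE mulgA mulVg mul1g.
by move: Ng; case: (N g t); case: (N g^-1 (s i)).
Qed.

Lemma reflection_sq t : reflection s t -> t * t = 1.
Proof.
by case=> g [i ->]; rewrite -!mulgA mulKg (mulgA (s i)) gen_sq mul1g mulgV.
Qed.

Lemma cocycle_mul_reflection r u : reflection s r -> N (r * u) r = ~~ N u r.
Proof.
by move=> rr; rewrite NM cocycle_reflection // conjgE mulgA mulVg mul1g.
Qed.

(** The exchange condition: if [r] is the first letter, delete it; otherwise recurse on the tail
    with [r] conjugated by that letter. *)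
Lemma cocycle_shorter (e : seq 'I_n) r : N (\prod_(i <- e) s i) r ->
  exists2 l, (l < size e)%N & has_word s (r * \prod_(i <- e) s i) l.
Proof.
elim: e r => [|i e IH] r; first by rewrite big_nil cocycle1.
rewrite big_cons NM Ns; have [->|_ /= /IH[l le [e' el re']]] := eqVneq r (s i).
  by move=> _; exists (size e) => //; exists e => //; rewrite mulgA gen_sq mul1g.
exists l.+1 => //; exists (i :: e'); first by rewrite /= el.
by rewrite big_cons -re' conjgE !mulgA mulgV mul1g.
Qed.

(** The cocycle at [r] is odd on exactly one of [u] and [r u], and exchange makes that one the
    longer. *)
Lemma cocycle_length r u lu lv : reflection s r ->
  has_length s u lu -> has_length s (r * u) lv -> N u r = (lv < lu)%N.
Proof.
have short v lv' lw : has_length s v lv' -> has_length s (r * v) lw ->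
    N v r -> (lw < lv')%N.
  case=> -[e <- ->] _ [_ lmin] /cocycle_shorter[l le /lmin] /leq_ltn_trans.
  exact.
move=> rr ul rul; case: (boolP (N u r)) => [/(short _ _ _ ul rul)->//|Nu].
apply/esym/negbTE; rewrite -leqNgt; apply: ltnW; apply: short rul _ _.
  by rewrite mulgA reflection_sq ?mul1g.
by rewrite cocycle_mul_reflection.
Qed.

Lemma length_reflection_neq r u l : reflection s r ->
  has_length s u l -> has_length s (r * u) l -> False.
Proof.
move=> rr ul rul; have := cocycle_length rr ul rul.
have := cocycle_length rr rul.
rewrite mulgA reflection_sq // mul1g cocycle_mul_reflection // => /(_ _ ul); rewrite ltnn.
by case: (N u r).
Qed.

End Cocycle.

Lemma bruhat_step_lengths u v : bruhat_step s u v ->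
  exists lu lv, [/\ has_length s u lu, has_length s v lv & (lu < lv)%N].
Proof. by case. Qed.

Lemma mulg_reflection (u t : W) : u * t = t ^ u^-1 * u.
Proof. by rewrite conjgE invgK -!mulgA mulVg mulg1. Qed.

(* For [v = r u] with [r] a reflection other than [u a u^-1], the cocycle takes
   the same value at [r] on [u] and on [u a]. *)
Lemma bruhat_step_mul_gen u v i : bruhat_step s u v -> v <> u * s i ->
  bruhat_step s (u * s i) (v * s i).
Proof.
move=> [[t tt vE] [lu [lv [ul vl ltuv]]]] vui.
have [N [NM Ns]] := reflection_cocycle HW.
have [lu' ul'] := has_word_exists_length (has_word_mul_gen i ul.1).
have [lv' vl'] := has_word_exists_length (has_word_mul_gen i vl.1).
set r := t ^ u^-1; have rr : reflection s r by apply: reflectionJ.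
have vr : v = r * u by rewrite vE mulg_reflection.
have viE : v * s i = r * (u * s i) by rewrite vr !mulgA.
have ru : r ^ u = t by rewrite /r conjgKV.
have Nu : N (u * s i) r = false.
  have vl2 : has_length s (r * u) lv by rewrite -vr.
  rewrite NM Ns ru (cocycle_length NM Ns rr ul vl2).
  rewrite ltnNge (ltnW ltuv) /=; apply/eqP => ti.
  by apply: vui; rewrite vE ti.
split.
  exists (t ^ s i); first exact: reflectionJ.
  by rewrite vE conjgE !mulgA mulgK.
exists lu', lv'; split=> //.
have := cocycle_length NM Ns rr ul'; rewrite -viE Nu => /(_ _ vl').
(* The cocycle only gives a weak inequality; equality is excluded because multiplying by a
   reflection changes the length. *)
move/esym/negbT; rewrite -leqNgt leq_eqVlt => /orP[/eqP ll|//].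
rewrite -ll in vl'.
by case: (length_reflection_neq NM Ns rr ul'); rewrite -viE.
Qed.

(** By induction along the chain it suffices to treat one step. Either [v = u a], and the pair
    [u, u a] is merely swapped, or [u a < v a] is again a step. *)
Lemma bruhat_lifting z u v i : bruhat s u v ->
  bruhat s z u -> bruhat s z (u * s i) ->
  bruhat s z v /\ bruhat s z (v * s i).
Proof.
move=> uv; elim: uv z => {u v} [u v uv|u|u v w _ IHu _ IHv] z zu zui //.
  split; first by apply: rt_trans zu _; apply: rt_step.
  have [->|vui] := pselect (v = u * s i); first by rewrite -mulgA gen_sq mulg1.
  by apply: rt_trans zui _; apply/rt_step/bruhat_step_mul_gen.
by have [zv zvi] := IHu z zu zui; apply: IHv.
Qed.

Lemma bruhat_lt_lengths u v : bruhat s u v -> u <> v ->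
  exists lu lv, [/\ has_length s u lu, has_length s v lv & (lu < lv)%N].
Proof.
elim=> {u v} [u v /bruhat_step_lengths//|//|u v w _ IHu _ IHv].
have [->//|uv] := pselect (u = v).
have [<- _|vw _] := pselect (v = w); first exact: IHu.
have [lu [lv [ul vl luv]]] := IHu uv.
have [lv' [lw [vl' wl lvw]]] := IHv vw.
exists lu, lw; split=> //; apply: ltn_trans luv _.
by rewrite (has_length_uniq vl vl').
Qed.

(** The existence of a length travels down from [v], in place of an argument that the [s i] generate
    [W]. *)
Lemma bruhat_below_length u v l : bruhat s u v -> has_length s v l ->
  exists lu, has_length s u lu.
Proof.
move=> uv vl; have [->|nuv] := pselect (u = v); first by exists l.
by have [lu [? []]] := bruhat_lt_lengths uv nuv; exists lu.
Qed.

Lemma bruhat_mul_gen_total w l i : has_length s w l ->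
  bruhat s w (w * s i) \/ bruhat s (w * s i) w.
Proof.
move=> wl; have [l' wl'] := has_word_exists_length (has_word_mul_gen i wl.1).
have [N [NM Ns]] := reflection_cocycle HW.
case: (ltngtP l l') => [ll'|ll'|ll'].
- left; apply: rt_step; split; last by exists l, l'.
  by exists (s i) => //; apply: reflection_gen.
- right; apply: rt_step; split; last by exists l', l.
  exists (s i); first exact: reflection_gen.
  by rewrite -mulgA gen_sq mulg1.
- rewrite -ll' mulg_reflection in wl'.
  case: (length_reflection_neq NM Ns _ wl wl').
  by apply: reflectionJ; apply: reflection_gen.
Qed.

End BruhatLifting.

(** * Contraction of H-stable primes *)

Section CauchonExtension.
Variables (k : fieldType) (R S : algType k).
Variables (iota : {lrmorphism R -> S}) (tau : {lrmorphism R -> R}) (tauV : R -> R).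
Variables (delta : {linear R -> R}) (x : S) (q : k) (H : groupType).
Variables (actR : H -> {lrmorphism R -> R}) (actS : H -> {lrmorphism S -> S}).
Hypothesis HS : cauchon_extension iota tau delta x q actR actS.
Hypotheses (tauK : cancel tau tauV) (tauVK : cancel tauV tau).

Local Notation Q := (skew_eval iota x).
Local Notation specR := (spec_H actR).

Lemma ore_comm_eval r : x * iota r = iota (tau r) * x + iota (delta r).
Proof. exact: (ore_comm (cauchon_ore HS)). Qed.

Lemma ore_eval_inj : injective Q.
Proof.
move=> p p' pp'; have [p0 [_ uniq_p]] := ore_free (cauchon_ore HS) (Q p).
have /uniq_p <- := skew_evalE iota x p.
by apply: uniq_p; rewrite pp' skew_evalE.
Qed.

Lemma ore_eval_surj y : exists p : {poly R}, y = Q p.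
Proof.
by have [p [yE _]] := ore_free (cauchon_ore HS) y; exists p; rewrite skew_evalE.
Qed.

Lemma ore_iota_inj : injective iota.
Proof.
by move=> r r' rr'; apply: polyC_inj; apply: ore_eval_inj; rewrite !skew_evalC.
Qed.

Lemma actS_invK h : cancel (actS h) (actS h^-1%g).
Proof.
have [act1 actM] := cauchon_action HS.
by move=> y; have := actM h^-1%g h y; rewrite mulVg act1 => /esym.
Qed.

Lemma actR_invK h : cancel (actR h) (actR h^-1%g).
Proof. by move=> r; apply: ore_iota_inj; rewrite -!(cauchon_R_stable HS) actS_invK. Qed.

Lemma ore_x_neq0 : x != 0.
Proof.
apply/eqP => x0; have /ore_eval_inj/eqP : Q 'X = Q 0.
  by rewrite skew_eval0 -['X]mul1r skew_evalMX [X in _ * X]x0 mulr0.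
by rewrite polyX_eq0.
Qed.

(** Apply [h] to the Ore relation and compare constant coefficients; [c] is the eigenvalue of [x],
    nonzero because [x] is. *)
Lemma actR_delta h : exists2 c : k, c != 0 &
  forall r, actR h (delta r) = c *: delta (actR h r).
Proof.
have [c xE] := cauchon_x_eigen HS h; exists c.
  apply/eqP => c0; have /eqP[] := ore_x_neq0.
  by rewrite -(actS_invK h x) xE c0 scale0r rmorph0.
move=> r; have := congr1 (actS h) (ore_comm_eval r).
rewrite rmorphM rmorphD rmorphM /= xE !(cauchon_R_stable HS) -scalerAl ore_comm_eval.
have iotaZ a u : iota (a *: u) = a *: iota u by rewrite linearZ.
rewrite scalerDr -scalerAr !scalerAl -!iotaZ => E.
have /ore_eval_inj/polyP/(_ 0%N) :
    Q ((c *: tau (actR h r))%:P * 'X + (c *: delta (actR h r))%:P) =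
    Q ((c *: actR h (tau r))%:P * 'X + (actR h (delta r))%:P).
  by rewrite !skew_evalD !skew_evalMX !skew_evalC.
by rewrite !coefD !coefMX !coefC /= !add0r.
Qed.

(** On [R], [tau] is the action of [h0] and [tauV] that of its inverse, so stability under [H] gives
    stability under both. *)
Lemma spec_H_tau P r : specR P -> P r -> P (tau r).
Proof.
case=> _ stab Pr; have [h0 [c [h0tau _ _]]] := cauchon_h0 HS.
by apply: (stab h0); exists r; rewrite ?h0tau.
Qed.

Lemma spec_H_tauV P r : specR P -> P r -> P (tauV r).
Proof.
case=> _ stab Pr; have [h0 [c [h0tau _ _]]] := cauchon_h0 HS.
apply: (stab h0^-1%g); exists r => //.
by rewrite -[r in LHS]tauVK -h0tau actR_invK.
Qed.

Lemma spec_H_completely_prime P : specR P -> completely_prime_ideal P.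
Proof.
move=> [[P_ideal PT Pprime] stab]; apply: (cauchon_H_prime HS).
by split=> // I J I_ideal _ J_ideal _; apply: Pprime.
Qed.

Lemma completely_prime_prime P : completely_prime_ideal P -> prime_ideal (A := R) P.
Proof.
move=> [P_ideal PT Pcp]; split=> // I J _ _ IJP.
have [|/existsNP[a /not_implyP[Ia Pa]]] := pselect (I `<=` P); first by left.
by right=> b Jb; have [] := Pcp a b (IJP _ _ Ia Jb).
Qed.

Lemma delta_core_spec_H P : specR P -> specR (delta_core delta P).
Proof.
move=> specP; have [[P_ideal _ _] stab] := specP; split.
  apply: completely_prime_prime.
  apply: (delta_core_completely_prime (cauchon_q_neq0 HS) (cauchon_q_root HS) tauK
    (cauchon_skew HS) (ore_delta_der (cauchon_ore HS)) (cauchon_nilp HS) P_ideal).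
  - by move=> r; apply: spec_H_tau.
  - by move=> r; apply: spec_H_tauV.
  - exact: spec_H_completely_prime.
move=> h _ [r Pr <-]; have [c c0 hd] := actR_delta h.
apply: (delta_core_morph P_ideal c0 hd) => // u Pu; apply: (stab h).
by exists u.
Qed.

Variables (L : unitAlgType k) (j : {lrmorphism S -> L}).
Hypothesis HL : localization j x.

Local Notation rho := (j \o iota : {lrmorphism R -> L}).

Lemma skew_eval_comp p : skew_eval rho (j x) p = j (Q p).
Proof.
rewrite !skew_evalE rmorph_sum; apply: eq_bigr => i _.
by rewrite rmorphM rmorphXn.
Qed.

Lemma cauchon_tilde_contraction P : specR P ->
  contraction iota (cauchon_tilde iota j tauV delta x q P) = delta_core delta P.
Proof.
move=> specP; have [[P_ideal _ _] _] := specP; have [j_inj jx_unit j_gen] := HL.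
have rho_free p : skew_eval rho (j x) p = 0 -> p = 0.
  rewrite skew_eval_comp => jp0; apply: ore_eval_inj; apply: j_inj.
  by rewrite jp0 skew_eval0 rmorph0.
have rho_gen y : exists (p : {poly R}) e, y * j x ^+ e = skew_eval rho (j x) p.
  have [u [l ->]] := j_gen y; have [p ->] := ore_eval_surj u.
  by exists p, l; rewrite skew_eval_comp mulrVK ?unitrX.
have rho_comm r : j x * rho r = rho (tau r) * j x + rho (delta r).
  by rewrite /= -rmorphM ore_comm_eval rmorphD rmorphM.
have contr r := cauchon_ideal_contraction (cauchon_q_neq0 HS) (cauchon_q_root HS)
  tauK tauVK (cauchon_skew HS) (ore_delta_der (cauchon_ore HS)) (cauchon_nilp HS)
  jx_unit rho_comm rho_free rho_gen r P_ideal
  (fun u => @spec_H_tau P u specP) (fun u => @spec_H_tauV P u specP).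
by apply/seteqP; split=> r /contr.
Qed.

Lemma cauchon_tilde_contraction_stable P : specR P -> delta @` P `<=` P ->
  contraction iota (cauchon_tilde iota j tauV delta x q P) = P.
Proof.
move=> specP dP; rewrite cauchon_tilde_contraction //; apply/seteqP; split.
  exact: delta_core_sub.
by apply: sub_delta_core => // r Pr; apply: dP; exists r.
Qed.

Lemma extend_x_contraction_spec_H P : specR P -> range delta `<=` P ->
  contraction iota (extend_x iota x P) = P.
Proof.
move=> specP dP; have [[P_ideal _ _] _] := specP.
exact: (extend_x_contraction ore_comm_eval ore_eval_inj ore_eval_surj P_ideal dP).
Qed.

Lemma cP2_or_cP3 P : specR P -> delta @` P `<=` P ->
  cP2 delta actR P \/ cP3 delta actR P.
Proof.
move=> specP dP; have [?|nP3] := pselect (cP3 delta actR P); first by right.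
by left; split.
Qed.

Lemma delta_core_cP2_or_cP3 P : specR P ->
  cP2 delta actR (delta_core delta P) \/ cP3 delta actR (delta_core delta P).
Proof.
move=> specP; apply: cP2_or_cP3; first exact: delta_core_spec_H.
by move=> _ [r Pr <-]; apply: delta_core_delta.
Qed.

End CauchonExtension.

(** * Commutativity of the square, by the position of [w] in the interval *)

Theorem corollary3p29
  (k : fieldType) (R S : algType k)
  (iota : {lrmorphism R -> S}) (tau : {lrmorphism R -> R}) (tauV : R -> R)
  (delta : {linear R -> R}) (x : S) (q : k) (H : groupType)
  (actR : H -> {lrmorphism R -> R}) (actS : H -> {lrmorphism S -> S})
  (HS : cauchon_extension iota tau delta x q actR actS)
  (Htorus : torus k H)
  (tauK : cancel tau tauV) (tauVK : cancel tauV tau)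
  (Hdiag : diagonalizable_map tau)
  (L : unitAlgType k) (j : {lrmorphism S -> L}) (HL : localization j x)
  (n : nat) (m : 'I_n -> 'I_n -> nat) (W : groupType) (s : 'I_n -> W)
  (HW : coxeter_group m s)
  (a wb : W) (Ha : exists i, a = s i) (Hwb : bruhat_lt s wb (wb * a)%g)
  (nabla : W -> set R)
  (Hnabla : poset_iso (bruhat s) (lower_interval s wb) (spec_H actR) nabla)
  (HAB :
    (nabla @` W3 s wb a = cP3 delta actR /\
     forall w, (W1 s wb a `|` W2 s wb a) w ->
       contraction iota (cauchon_tilde iota j tauV delta x q (nabla w))
         = nabla (Phi s a w))
    \/
    [/\ nabla @` W1 s wb a = cP1 delta actR,
        nabla @` W2 s wb a = cP2 delta actR
      & nabla @` W3 s wb a = cP3 delta actR]) :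
  forall w, lower_interval s (wb * a)%g w ->
    contraction iota
      (nabla_tilde s wb a (cauchon_tilde iota j tauV delta x q)
         (extend_x iota x) nabla w)
    = nabla (Phi s a w).
Proof.
case: Ha Hwb HAB => i -> {a} [wb_le wb_neq] HAB.
have [_ [lwa [_ wbal _]]] := bruhat_lt_lengths wb_le wb_neq.
have mulaa w : (w * s i * s i = w)%g by rewrite -mulgA (coxeter_gen_sq HW) mulg1.
have lift w v : bruhat s v w -> bruhat s v (v * s i)%g -> bruhat s v (w * s i)%g.
  by move=> vw vva; have [] := bruhat_lifting HW vw (rt_refl _ _ _) vva.
have below w : bruhat s w (wb * s i)%g -> bruhat s w (w * s i)%g -> bruhat s w wb.
  by move=> ww wwa; rewrite -(mulaa wb); apply: lift.
have below_mul w : bruhat s w (wb * s i)%g -> bruhat s (w * s i)%g w ->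
    bruhat s (w * s i)%g wb.
  move=> ww waw; rewrite -(mulaa wb).
  by have [] := bruhat_lifting HW ww waw (rt_refl _ _ _).
have total w : bruhat s w (wb * s i)%g ->
    bruhat s w (w * s i)%g \/ bruhat s (w * s i)%g w.
  by move=> /bruhat_below_length /(_ wbal) [l wl]; exact: (bruhat_mul_gen_total HW i wl).
have [[nabla_fun nabla_inj nabla_surj] nabla_le] := Hnabla.
have W3_cP3 : nabla @` W3 s wb (s i) = cP3 delta actR by case: HAB => [[]|[]].
(* On [W3], [Phi] is the identity: [w a <= w] would lift to [w a <= wb]. *)
have W3_le w : W3 s wb (s i) w -> bruhat s w (w * s i)%g /\ bruhat s w wb.
  move=> [ww nwa]; have [wwa|/(below_mul _ ww)//] := total w ww.
  by split=> //; apply: below.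
have W3_contr w : W3 s wb (s i) w ->
    contraction iota (cauchon_tilde iota j tauV delta x q (nabla w)) = nabla w.
  move=> wW3; have : cP3 delta actR (nabla w) by rewrite -W3_cP3; exists w.
  move=> [specP dP]; apply: (cauchon_tilde_contraction_stable HS tauK tauVK HL specP).
  by move=> _ [r _ <-]; apply: dP; exists r.
move=> w w_le; rewrite /nabla_tilde /Phi.
(* When [w] is not below [wb], lifting forces [w a <= w], and [w a] lies in [W3]; so the ideal
   extended by [x] contains [delta R]. *)
case: pselect => [w_wb|w_nwb]; last first.
  case: pselect => [/(below _ w_le)//|nwwa].
  have [//|waw] := total w w_le; have wawb := below_mul w w_le waw.
  have [specP dP] : cP3 delta actR (nabla (w * s i)%g).
    rewrite -W3_cP3; exists (w * s i)%g => //; split; last by rewrite mulaa.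
    exact: rt_trans wawb wb_le.
  exact: (extend_x_contraction_spec_H HS specP dP).
have specw : spec_H actR (nabla w) by apply: nabla_fun.
have [wawb|nwawb] := pselect (bruhat s (w * s i)%g wb); last first.
  have wW3 : W3 s wb (s i) w by split.
  case: pselect => [?|nwwa] /=; first exact: W3_contr.
  by case: nwwa; case: (W3_le w wW3).
have [wwa|nwwa] := pselect (bruhat s w (w * s i)%g).
  have wW2 : W2 s wb (s i) w by split.
  case: HAB => [[_ ->]|[_ W2_cP2 _]].
  - by rewrite /Phi; case: pselect.
  - by right.
  have [[_ dP] _] : cP2 delta actR (nabla w) by rewrite -W2_cP2; exists w.
  case: pselect => //= ?.
  exact: (cauchon_tilde_contraction_stable HS tauK tauVK HL specw dP).
have waw : bruhat s (w * s i)%g w by case: (total w w_le).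
have wW1 : W1 s wb (s i) w by split.
case: HAB => [[_ /(_ w)]|[_ W2_cP2 _]].
  by rewrite /Phi => -> //; left.
case: pselect => [//|_] /=.
rewrite (cauchon_tilde_contraction HS tauK tauVK HL specw).
(* The core is in [cP2] or [cP3], hence in the image of [W2] or [W3], and both give [v <= v a]. *)
have [v [vwb vva vE]] : exists v, [/\ bruhat s v wb, bruhat s v (v * s i)%g &
    nabla v = delta_core delta (nabla w)].
  have [] := delta_core_cP2_or_cP3 HS tauK tauVK specw.
    rewrite -W2_cP2 => -[v [v_le vva vawb] <-]; exists v; split=> //.
    exact: rt_trans vva vawb.
  by rewrite -W3_cP3 => -[v /W3_le[vva vwb] <-]; exists v.
apply/seteqP; split.
  rewrite -vE; apply/(nabla_le v (w * s i)%g) => //; apply: lift vva.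
  by apply/(nabla_le v w) => //; rewrite vE; apply: delta_core_sub.
(* Here [w a] lies in [W2], because [(w a) a = w] is above [w a] and below [wb]. *)
have [[_ dP] _] : cP2 delta actR (nabla (w * s i)%g).
  rewrite -W2_cP2; exists (w * s i)%g => //; split; rewrite ?mulaa //.
  exact: rt_trans waw w_le.
apply: sub_delta_core => [|r Pr]; last by apply: dP; exists r.
by apply/(nabla_le (w * s i)%g w).
Qed.
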